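(* Let $m\ge 2$, let $f\in\mathbb{R}^{d_1\times\cdots\times d_m}$ be a nonnegative weakly irreducible tensor and $1<p_1,\dots,p_m<\infty$ such that there exists $i\in[m]$ with $m-1\le (p_i-1)\big(\min_{k\in[m]\setminus\{i\}}p_k-(m-1)\big)$. Let $(\lambda_-^k)_{k\in\mathbb N}$, $(\lambda_+^k)_{k\in\mathbb N}$ and $(\mathbf x^k)_{k\in\mathbb N}$ be the sequences produced by the Higher-order Generalized Power Method (HGPM). Let $\tilde{\mathbf x}^*\in\mathcal S^d_{++}$ be a singular vector of $f$ with $Q(\tilde{\mathbf x}^* )=\|f\|_{p_1,\ldots,p_m}$ and let $\mathbf x^*:=(\tilde{\mathbf x}^*_1,\dots,\tilde{\mathbf x}^*_{i-1},\tilde{\mathbf x}^*_{i+1},\dots,\tilde{\mathbf x}^*_m)$, where $i$ is the index chosen in the initialization of HGPM. Then for all $k\in\mathbb N$, $$\lambda_-^k\le\lambda_-^{k+1}\le\|f\|_{p_1,\ldots,p_m}\le\lambda_+^{k+1}\le\lambda_+^k,\qquad \lim_{k\to\infty}\lambda_-^k=\|f\|_{p_1,\ldots,p_m}=\lim_{k\to\infty}\lambda_+^k,\qquad \lim_{k\to\infty}\mathbf x^k=\mathbf x^*,$$ and there exist $0<\nu<1$, $k_0\in\mathbb N$ and a norm $\|\cdot\|_G$ such that $\|\mathbf x^{k+1}-\mathbf x^*\|_G\le\nu\|\mathbf x^k-\mathbf x^*\|_G$ for all $k\ge k_0$.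
   Context: $[n]=\{1,\dots,n\}$; $f$ is identified with the multilinear form $f(\mathbf x_1,\ldots,\mathbf x_m)=\sum_{j_1,\ldots,j_m}f_{j_1,\ldots,j_m}x_{1,j_1}\cdots x_{m,j_m}$ on $\mathcal R^d=\mathbb{R}^{d_1}\times\cdots\times\mathbb{R}^{d_m}$. Inequalities entrywise. $p'=p/(p-1)$; $\psi_q(\mathbf y)_j=|y_j|^{q-1}\mathrm{sign}(y_j)$. $Q(\mathbf x)=|f(\mathbf x)|/\prod_k\|\mathbf x_k\|_{p_k}$, $\|f\|_{p_1,\ldots,p_m}=\max Q$. $\mathcal S^d_{++}=\{\mathbf x>0:\|\mathbf x_k\|_{p_k}=1\ \forall k\}$; singular vectors of $f$ are critical points of $Q$ (with $f(\mathbf x)\ne0$). $\nabla_kf(\mathbf x)$ is the vector of partial derivatives $\partial f/\partial x_{k,j_k}$; it does not depend on $\mathbf x_k$, so $\nabla_if(\mathbf x)$ makes sense for $\mathbf x\in\mathcal R^{d-d_i}:=\prod_{k\ne i}\mathbb{R}^{d_k}$. $\mathcal S^{d-d_i}_{++}=\{\mathbf x\in\mathcal R^{d-d_i}:\mathbf x>0,\|\mathbf x_k\|_{p_k}=1\ \forall k\neq i\}$. For $k\ne i$ and $\mathbf x\in\mathcal R^{d-d_i}$: $s_{i,k}(\mathbf x)=\psi_{p_k'}\big(\nabla_kf(\mathbf x_1,\ldots,\mathbf x_{i-1},\psi_{p_i'}(\nabla_if(\mathbf x)),\mathbf x_{i+1},\ldots,\mathbf x_m)\big)\in\mathbb{R}^{d_k}$.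 Weak irreducibility: the undirected graph on $V=\bigcup_k\{k\}\times[d_k]$, with $(k,j_k)\sim(l,j_l)$ ($k\ne l$) iff some $f_{j_1,\ldots,j_m}>0$ with these two indices fixed, is connected. HGPM: input $f$, $p_1,\dots,p_m$, $\epsilon>0$. Initialization: choose $i\in[m]$ with $(m-1)p_i'\le p_k$ for all $k\ne i$ (if $m=2$, choose $i$ with $p_i\le p_k$ for $k\ne i$); choose $\mathbf x^0\in\mathcal S^{d-d_i}_{++}$. For $k=0,1,2,\dots$: $\mathbf z^k=(s_{i,l}(\mathbf x^k))_{l\ne i}$; $\lambda_-^{k+1}=\prod_{l\ne i}\min_{j_l}(z^k_{l,j_l}/x^k_{l,j_l})^{(p_l-1)/(p_i'(m-1))}$, $\lambda_+^{k+1}=\prod_{l\ne i}\max_{j_l}(z^k_{l,j_l}/x^k_{l,j_l})^{(p_l-1)/(p_i'(m-1))}$; $\mathbf x^{k+1}=(\mathbf z^k_l/\|\mathbf z^k_l\|_{p_l})_{l\ne i}$; stop when $\lambda_+^k-\lambda_-^k<\epsilon$ (for the asymptotic statements the iteration is continued indefinitely). Here $\mathbb N=\{1,2,\dots\}$ for the index of the $\lambda$-sequences. *)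

(* Defs.v *)
From HB Require Import structures.
From mathcomp Require Import all_boot all_order all_algebra.
From mathcomp Require Import all_classical all_reals all_analysis.
Set Implicit Arguments. Unset Strict Implicit. Unset Printing Implicit Defensive.
Import Order.TTheory GRing.Theory Num.Theory.
Import numFieldNormedType.Exports.
Local Open Scope classical_set_scope.
Local Open Scope ring_scope.

Section HGPM.
Variables (R : realType) (m : nat) (d : 'I_m -> nat).

Definition mindex := {dffun forall k : 'I_m, 'I_(d k)}.
Definition tensor := mindex -> R.
Definition state := forall k : 'I_m, 'I_(d k) -> R.

Definition upd (x : state) (k : 'I_m) (v : 'I_(d k) -> R) : state :=
  @dfwith _ (fun k => 'I_(d k) -> R) x k v.

Definition sub_state (x y : state) : state := fun l j => x l j - y l j.
Definition add_state (x y : state) : state := fun l j => x l j + y l j.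
Definition scale_state (a : R) (x : state) : state := fun l j => a * x l j.

Definition mlform (f : tensor) (x : state) : R :=
  \sum_(j : mindex) f j * \prod_(k < m) x k (j k).

Definition grad (f : tensor) (k : 'I_m) (x : state) : 'I_(d k) -> R :=
  fun a => \sum_(j : mindex | j k == a) f j * \prod_(l < m | l != k) x l (j l).

Definition pnorm (n : nat) (q : R) (v : 'I_n -> R) : R :=
  (\sum_(j < n) `|v j| `^ q) `^ q^-1.

Definition psi (n : nat) (q : R) (v : 'I_n -> R) : 'I_n -> R :=
  fun j => `|v j| `^ (q - 1) * Num.sg (v j).

Definition hconj (q : R) : R := q / (q - 1).

Definition Qf (f : tensor) (p : 'I_m -> R) (x : state) : R :=
  `|mlform f x| / \prod_(k < m) pnorm (p k) (x k).

Definition tnorm (f : tensor) (p : 'I_m -> R) : R :=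
  sup [set Qf f p x | x in [set x : state | forall k, exists j, x k j != 0]].

Definition nonneg_tensor (f : tensor) : Prop := forall j, 0 <= f j.

Definition vert := {k : 'I_m & 'I_(d k)}.
Definition wi_edge (f : tensor) : rel vert :=
  fun u v => (tag u != tag v) &&
    [exists j : mindex, [&& j (tag u) == tagged u, j (tag v) == tagged v & 0 < f j]].
Definition weakly_irreducible (f : tensor) : Prop :=
  forall u v : vert, connect (wi_edge f) u v.

Definition in_Spp (p : 'I_m -> R) (x : state) : Prop :=
  forall k, (forall j, 0 < x k j) /\ pnorm (p k) (x k) = 1.
(* S^{d-d_i}_{++}, points of R^{d-d_i} represented as states whose i-th slot is ignored *)
Definition in_Spp_i (p : 'I_m -> R) (i : 'I_m) (x : state) : Prop :=
  forall k, k != i -> (forall j, 0 < x k j) /\ pnorm (p k) (x k) = 1.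

Definition singular_vector (f : tensor) (p : 'I_m -> R) (x : state) : Prop :=
  mlform f x != 0 /\
  forall (k : 'I_m) (a : 'I_(d k)),
    is_derive (0 : R) (1 : R)
      (fun t : R => Qf f p (@upd x k (fun b => x k b + (if b == a then t else 0)))) 0.

Definition s_ik (f : tensor) (p : 'I_m -> R) (i k : 'I_m) (x : state) : 'I_(d k) -> R :=
  psi (hconj (p k)) (@grad f k (@upd x i (psi (hconj (p i)) (@grad f i x)))).

Definition hgpm_index (p : 'I_m -> R) (i : 'I_m) : Prop :=
  if (m == 2)%N then forall k, k != i -> p i <= p k
  else forall k, k != i -> (m - 1)%:R * hconj (p i) <= p k.

(* one HGPM step x^k |-> x^{k+1}; the (ignored) i-th slot is left unchanged *)
Definition hgpm_step (f : tensor) (p : 'I_m -> R) (i : 'I_m) (x : state) : state :=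
  fun l => if l == i then x l
           else fun j => @s_ik f p i l x j / pnorm (p l) (@s_ik f p i l x).

Definition hgpm_x (f : tensor) (p : 'I_m -> R) (i : 'I_m) (x0 : state) (n : nat) : state :=
  iter n (hgpm_step f p i) x0.

(* lambda_-^{k+1} and lambda_+^{k+1}, computed from x = x^k *)
Definition hgpm_lam_minus (f : tensor) (p : 'I_m -> R) (i : 'I_m) (x : state) : R :=
  \prod_(l < m | l != i)
    (inf (range (fun j : 'I_(d l) => @s_ik f p i l x j / x l j)))
      `^ ((p l - 1) / (hconj (p i) * (m - 1)%:R)).
Definition hgpm_lam_plus (f : tensor) (p : 'I_m -> R) (i : 'I_m) (x : state) : R :=
  \prod_(l < m | l != i)
    (sup (range (fun j : 'I_(d l) => @s_ik f p i l x j / x l j)))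
      `^ ((p l - 1) / (hconj (p i) * (m - 1)%:R)).

(* a norm on R^{d-d_i}, viewed as a function on states that ignores the i-th slot:
   a seminorm on states whose kernel is exactly the set of states vanishing off slot i *)
Definition is_norm_off (i : 'I_m) (N : state -> R) : Prop :=
  (forall x y, N (add_state x y) <= N x + N y) /\
  (forall a x, N (scale_state a x) = `|a| * N x) /\
  (forall x, N x = 0 <-> (forall l, l != i -> forall j, x l j = 0)).

End HGPM.

(* Main.v *)
Require Import Defs.
From HB Require Import structures.
From mathcomp Require Import all_boot all_order all_algebra.
From mathcomp Require Import all_classical all_reals all_analysis.
From mathcomp Require Import ring lra.
Set Implicit Arguments. Unset Strict Implicit. Unset Printing Implicit Defensive.
Import Order.TTheory GRing.Theory Num.Theory.
Import numFieldNormedType.Exports.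
Local Open Scope classical_set_scope.
Local Open Scope ring_scope.

(* Write [x = xt * expR u] blockwise and weight the multi-index [j] by
   [rho j = f j * \prod_k xt k (j k) / lam], with [lam = f(xt)].  Criticality of
   [xt] says exactly that [rho] is a probability whose [k]-th marginal is
   [xt k a `^ p k], and in the coordinate [u] the iteration is built from
   conditional log-averages [ln E[expR _ | j_l = a]].  It is therefore monotone and
   homogeneous, which under [(m - 1) p_i' <= p_l] makes the two bounds monotone and
   the iteration nonexpansive for the oscillation seminorm.  Its linearization at
   [0] is symmetric for the inner product weighted by [(p_l - 1) rho]; the defect
   of its quadratic form is a Dirichlet energy, which weak irreducibility bounds
   from below by a Poincare inequality, so the linearization is a strict
   contraction.  Hence the iteration contracts near [0], and nonexpansiveness
   spreads the convergence to all starting points. *)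

(** Equality [(m - 1) p_i' = p_l] is allowed, and then comparison yields no more than
    nonexpansiveness: a global contraction argument is out of reach. Two norms share the work. The
    oscillation seminorm is kept under control everywhere but gives no rate; the Hilbert norm gives
    a rate, but only where the linearization is accurate. For the symmetric linearization both ends
    of the spectrum matter: the Poincare inequality keeps the form away from [1], and a separate
    lower bound keeps it away from [-1]. The constants in each block, which reflect the scaling of
    that block, carry no information: normalization discards them, so that a point may be centered
    before it is linearized. Slot [i] is eliminated from the iteration but its vertices belong to
    the graph; a conditional mean supplies the missing values there. No derivative of the iteration
    is computed: Jensen's inequality below and a quadratic bound on [expR] above enclose a
    log-average between the average and the average plus [O(e ^ 2)]. *)

Section Averages.
Variables (R : realType) (J : finType).
Implicit Types (w h k : J -> R) (c e : R).

(** * Averages and log-averages for a finite probability *)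

Definition prob w := (forall j, 0 <= w j) /\ \sum_j w j = 1.
Definition av w h := \sum_j w j * h j.
Definition lav w h := ln (av w (fun j => expR (h j))).

Lemma avD w h k : av w (fun j => h j + k j) = av w h + av w k.
Proof. by rewrite /av -big_split; apply: eq_bigr => j _; rewrite mulrDr. Qed.

Lemma avZ w c h : av w (fun j => c * h j) = c * av w h.
Proof. by rewrite /av mulr_sumr; apply: eq_bigr => j _; rewrite mulrCA. Qed.

Lemma avB w h k : av w (fun j => h j - k j) = av w h - av w k.
Proof.
rewrite (_ : (fun j => _) = (fun j => h j + (-1) * k j)).
  by rewrite avD avZ mulN1r.
by apply: funext => j; rewrite mulN1r.
Qed.

Lemma av_sum w (I : finType) (P : pred I) (F : I -> J -> R) :
  av w (fun j => \sum_(l | P l) F l j) = \sum_(l | P l) av w (F l).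
Proof.
by rewrite /av exchange_big; apply: eq_bigr => j _; rewrite mulr_sumr.
Qed.

Lemma eq_av w h k : h =1 k -> av w h = av w k.
Proof. by move=> hk; apply: eq_bigr => j _; rewrite hk. Qed.

Variable w : J -> R.
Hypothesis pw : prob w.

Lemma av_cst c : av w (fun=> c) = c.
Proof. by case: pw => _ w1; rewrite /av -mulr_suml w1 mul1r. Qed.

Lemma av_le h k : (forall j, h j <= k j) -> av w h <= av w k.
Proof.
by case: pw => w0 _ hk; apply: ler_sum => j _; apply: ler_wpM2l.
Qed.

Lemma av_le_cst h c : (forall j, h j <= c) -> av w h <= c.
Proof. by move=> hc; rewrite -[leRHS]av_cst; exact: av_le. Qed.

Lemma av_ge_cst h c : (forall j, c <= h j) -> c <= av w h.
Proof. by move=> hc; rewrite -[leLHS]av_cst; exact: av_le. Qed.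

Lemma av_norm h e : (forall j, `|h j| <= e) -> `|av w h| <= e.
Proof.
move=> he; rewrite ler_norml av_ge_cst ?av_le_cst// => j.
- by have := he j; rewrite ler_norml => /andP[].
- by have := he j; rewrite ler_norml => /andP[].
Qed.

(* Jensen's inequality, from [expR h >= expR (av h) * (1 + h - av h)]. *)
Lemma av_expR_ge h : expR (av w h) <= av w (fun j => expR (h j)).
Proof.
have -> : expR (av w h) =
    av w (fun j => expR (av w h) * (1 + (h j - av w h))).
  by rewrite avZ avD av_cst avB av_cst subrr addr0 mulr1.
apply: av_le => j.
rewrite -[in leRHS](subrK (av w h) (h j)) addrC expRD.
by rewrite addrC mulrC ler_wpM2r ?expR_ge0// expR_ge1Dx.
Qed.

Lemma av_expR_gt0 h : 0 < av w (fun j => expR (h j)).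
Proof. exact: lt_le_trans (expR_gt0 _) (av_expR_ge h). Qed.

Lemma expR_lav h : expR (lav w h) = av w (fun j => expR (h j)).
Proof. by rewrite lnK// posrE av_expR_gt0. Qed.

Lemma lav_ge h : av w h <= lav w h.
Proof. by rewrite -ler_expR expR_lav av_expR_ge. Qed.

(** Monotonicity and translation equivariance of [lav] in one inequality, the form in which all
    comparison estimates draw on them. *)
Lemma lav_leD h k c : (forall j, h j <= k j + c) -> lav w h <= lav w k + c.
Proof.
move=> hk; rewrite -ler_expR expRD !expR_lav mulrC -avZ; apply: av_le => j.
by rewrite mulrC -expRD ler_expR.
Qed.

Lemma lav_cst c : lav w (fun=> c) = c.
Proof. by rewrite /lav av_cst expRK. Qed.

Lemma lav_norm h e : (forall j, `|h j| <= e) -> `|lav w h| <= e.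
Proof.
move=> he; rewrite ler_norml; apply/andP; split.
  by apply: le_trans (lav_ge h); have := av_norm he; rewrite ler_norml => /andP[].
rewrite -[leRHS]add0r -[X in _ <= X + _](lav_cst 0); apply: lav_leD => j.
by rewrite add0r (le_trans (ler_norm _)).
Qed.

(** From [expR x <= (1 - x)^-1]: the factor 2 is chosen so that [(1 - x) * (1 + x + 2 * x ^+ 2) = 1
    + x ^+ 2 * (1 - 2 * x)], which is at least 1 for [x <= 1/2]. *)
Lemma expR_le_quad (x : R) : x <= 2^-1 -> expR x <= 1 + x + 2 * x ^+ 2.
Proof.
move=> x2; have x1 : 0 < 1 - x by lra.
have : expR x <= (1 - x)^-1.
  rewrite -[leLHS]invrK lef_pV2 ?posrE ?invr_gt0 ?expR_gt0// -expRN.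
  exact: expR_ge1Dx.
move/le_trans; apply.
rewrite -[leLHS]mulr1 ler_pdivrMl//.
have : 0 <= x ^+ 2 * (1 - 2 * x) by apply: mulr_ge0; [exact: sqr_ge0|lra].
by rewrite (_ : (1 - x) * _ = 1 + x ^+ 2 * (1 - 2 * x)); [lra|ring].
Qed.

(** With [lav_ge] this replaces differentiation: [lav] agrees with the linear functional [av] up to
    an explicit quadratic error. *)
Lemma lav_le_quad h e : e <= 2^-1 -> (forall j, `|h j| <= e) ->
  lav w h <= av w h + 2 * e ^+ 2.
Proof.
move=> e2 he; rewrite -ler_expR expR_lav.
apply: le_trans (expR_ge1Dx _).
rewrite -[X in _ <= X + _](av_cst 1) -[X in _ <= _ + (_ + X)](av_cst (2 * e ^+ 2)).
rewrite -!avD; apply: av_le => j.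
apply: le_trans (expR_le_quad _) _.
  by rewrite (le_trans (ler_norm _))// (le_trans (he j)).
rewrite -addrA !lerD2l ler_pM2l// -real_normK ?num_real//.
by rewrite lerXn2r ?nnegrE// (le_trans _ (he j)).
Qed.

End Averages.

(** * The iteration in logarithmic coordinates *)

Section Dynamics.
Variables (R : realType) (m : nat) (d : 'I_m -> nat).
Variables (i : 'I_m) (p : 'I_m -> R) (q : R) (rho : mindex d -> R).
Local Notation J := (mindex d).
Local Notation state := (state R d).
Local Notation n := ((m - 1)%:R : R).
Implicit Types (u v x : state) (M : 'I_m -> R) (c D e : R).

Definition mu (l : 'I_m) (a : 'I_(d l)) : R := \sum_(j : J | j l == a) rho j.
Arguments mu : clear implicits.
(** The conditional law of [rho] given [j l = a], extended by zero to all multi-indices so that [av]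
    and [lav] apply to it unchanged. *)
Definition wt (l : 'I_m) (a : 'I_(d l)) (j : J) : R :=
  if j l == a then rho j / mu l a else 0.
Arguments wt : clear implicits.

(* [log_s u] is the logarithm of [s_ik x / xt], up to a constant in each block,
   where [q = p_i' - 1]; [log_norm] is the logarithm of the [p_l]-norm. *)
Definition logsum u (j : J) : R := \sum_(k | k != i) u k (j k).
Definition logsum_but (l : 'I_m) u (j : J) : R :=
  \sum_(k | (k != i) && (k != l)) u k (j k).
Definition inner_log u (b : 'I_(d i)) : R := lav (wt i b) (logsum u).
Definition outer_log u (l : 'I_m) (j : J) : R :=
  logsum_but l u j + q * inner_log u (j i).
Definition log_s u : state := fun l a => lav (wt l a) (outer_log u l) / (p l - 1).
Arguments log_s : clear implicits.
Definition log_norm u (l : 'I_m) : R :=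
  lav rho (fun j => p l * u l (j l)) / p l.
Definition log_step u : state := fun l a => log_s u l a - log_norm (log_s u) l.
Arguments log_step : clear implicits.

(** In the original variables: every block off [i] has unit norm. *)
Definition normalized u := forall l, l != i -> log_norm u l = 0.

Hypothesis rho_prob : prob rho.
Hypothesis mu_gt0 : forall l a, 0 < mu l a.
Hypothesis q_gt0 : 0 < q.
Hypothesis p_gt1 : forall l, 1 < p l.
Hypothesis p_ge : forall l, l != i -> n * (1 + q) <= p l.

Let rho_ge0 j : 0 <= rho j. Proof. by case: rho_prob. Qed.
Let pm1_gt0 l : 0 < p l - 1. Proof. by rewrite subr_gt0. Qed.
Let p_gt0 l : 0 < p l. Proof. by rewrite (lt_trans _ (p_gt1 l)). Qed.
Hint Resolve rho_prob q_gt0 pm1_gt0 p_gt0 : core.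

Lemma prob_wt l a : prob (wt l a).
Proof.
split=> [j|]; rewrite /wt; first by case: ifP => // _; rewrite divr_ge0// ltW.
by rewrite -big_mkcond/= -mulr_suml divff// gt_eqF// mu_gt0.
Qed.
Hint Resolve prob_wt : core.

Lemma av_wt l a (h : J -> R) :
  av (wt l a) h = (\sum_(j : J | j l == a) rho j * h j) / mu l a.
Proof.
rewrite /av mulr_suml [RHS]big_mkcond; apply: eq_bigr => j _.
by rewrite /wt; case: ifP => _; rewrite ?mul0r// mulrAC.
Qed.

(** The tower property of conditional expectation; with [phi] itself a conditional mean it says that
    conditioning is a symmetric operator. *)
Lemma av_tower l (phi : 'I_(d l) -> R) (h : J -> R) :
  av rho (fun j => phi (j l) * av (wt l (j l)) h) =
  av rho (fun j => phi (j l) * h j).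
Proof.
rewrite /av (partition_big (fun j : J => j l) xpredT)//=.
rewrite [RHS](partition_big (fun j : J => j l) xpredT)//=.
apply: eq_bigr => a _.
rewrite (eq_bigr (fun j => rho j * (phi a * av (wt l a) h))); last first.
  by move=> j /eqP <-.
rewrite -mulr_suml -/(mu l a) av_wt mulrCA [mu l a * _]mulrC divfK ?gt_eqF//.
rewrite mulr_sumr; apply: eq_bigr => j /eqP <-.
by rewrite mulrCA.
Qed.

Lemma card_off_i : \sum_(k : 'I_m | k != i) (1 : R) = n.
Proof.
rewrite sumr_const; congr (_ *+ _).
have -> : #|[pred k : 'I_m | k != i]| = #|predC1 i| by apply: eq_card.
by rewrite cardC1 card_ord subn1.
Qed.

Lemma logsumE u l j : l != i -> logsum u j = u l (j l) + logsum_but l u j.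
Proof. by move=> li; rewrite /logsum (bigD1 l). Qed.

(** A shift of block [k] reaches block [l] directly when [k] differs from [l], and for every [k] a
    second time, with factor [q], through slot [i]. This gives [(1 + q)] times the total shift,
    minus the missing direct share [M l]. *)
Lemma log_s_leD u v M :
  (forall l, l != i -> forall a, u l a <= v l a + M l) ->
  forall l, l != i -> forall a,
  log_s u l a <=
    log_s v l a + ((1 + q) * (\sum_(k | k != i) M k) - M l) / (p l - 1).
Proof.
move=> uv l li a; rewrite /log_s -mulrDl ler_pM2r ?invr_gt0//.
apply: lav_leD => // j; rewrite /outer_log.
have h1 : logsum_but l u j <=
    logsum_but l v j + ((\sum_(k | k != i) M k) - M l).
  rewrite [X in _ + (X - _)](bigD1 l)//= addrAC subrr add0r -big_split/=.
  by apply: ler_sum => k /andP[ki _]; exact: uv.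
have h2 : inner_log u (j i) <= inner_log v (j i) + \sum_(k | k != i) M k.
  apply: lav_leD => // j'; rewrite -big_split/=.
  by apply: ler_sum => k ki; exact: uv.
have := ler_wpM2l (ltW q_gt0) h2; lra.
Qed.

Lemma log_norm_leD u v l c : (forall a, u l a <= v l a + c) ->
  log_norm u l <= log_norm v l + c.
Proof.
move=> uv; rewrite /log_norm ler_pdivrMr// mulrDl divfK ?gt_eqF//.
by apply: lav_leD => // j; rewrite -[c * _]mulrC -mulrDr ler_pM2l.
Qed.

Lemma log_norm_cst c l : log_norm (fun _ _ => c) l = c.
Proof. by rewrite /log_norm lav_cst// mulrC mulKf// gt_eqF. Qed.

Lemma log_step_normalized u : normalized (log_step u).
Proof.
move=> l li; apply/le_anti/andP; split.
  apply: (le_trans (log_norm_leD (v := log_s u) (c := - log_norm (log_s u) l) _)).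
    by move=> a; rewrite /log_step.
  by rewrite subrr.
rewrite -(lerD2r (log_norm (log_s u) l)) add0r.
by apply: log_norm_leD => a; rewrite /log_step subrK.
Qed.

(** * Monotonicity of the two bounds *)

Definition wsum M : R := \sum_(l | l != i) (p l - 1) * M l.

(** With [c] the log-norms of [log_s u], normalization of [u] gives [c l <= M l]. Since [log_step u]
    is at most [u + (M - c)], [log_s_leD] supplies the new rate [M'], and [wsum M - wsum M'] is the
    sum of [(p l - n * (1 + q)) * (M l - c l)], where both factors are nonnegative. *)
Lemma upper_rate_step u M : normalized u ->
  (forall l, l != i -> forall a, log_s u l a <= u l a + M l) ->
  exists2 M', wsum M' <= wsum M & forall l, l != i -> forall a,
    log_s (log_step u) l a <= log_step u l a + M' l.
Proof.
move=> nu uM; set c := log_norm (log_s u).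
have cM l : l != i -> c l <= M l.
  by move=> li; rewrite -[leRHS]add0r -(nu l li); exact/log_norm_leD/uM.
exists (fun l => c l + ((1 + q) * (\sum_(k | k != i) (M k - c k))
   - (M l - c l)) / (p l - 1)).
  have -> : wsum (fun l => c l + ((1 + q) * (\sum_(k | k != i) (M k - c k))
     - (M l - c l)) / (p l - 1)) =
     wsum M - \sum_(l | l != i) (p l - n * (1 + q)) * (M l - c l).
    set A := \sum_(k | k != i) (M k - c k).
    rewrite /wsum -sumrB.
    have -> : \sum_(l | l != i) ((p l - 1) * M l
                 - (p l - n * (1 + q)) * (M l - c l)) =
      \sum_(l | l != i) ((p l * c l - M l) + n * (1 + q) * (M l - c l)).
      by apply: eq_bigr => l _; ring.
    rewrite big_split/= -mulr_sumr -/A -card_off_i !mulr_suml.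
    rewrite -big_split/=; apply: eq_bigr => l _.
    by field; rewrite gt_eqF.
  rewrite gerBl sumr_ge0// => l li.
  by rewrite mulr_ge0// subr_ge0 ?cM// p_ge.
move=> l li a.
have h : forall l, l != i -> forall a, log_step u l a <= u l a + (M l - c l).
  by move=> k ki b; rewrite /log_step -/c; have := uM k ki b; lra.
apply: le_trans (log_s_leD h li a) _.
by rewrite addrA lerD2r /log_step subrK.
Qed.

Lemma lower_rate_step u M : normalized u ->
  (forall l, l != i -> forall a, u l a + M l <= log_s u l a) ->
  exists2 M', wsum M <= wsum M' & forall l, l != i -> forall a,
    log_step u l a + M' l <= log_s (log_step u) l a.
Proof.
move=> nu uM; set c := log_norm (log_s u).
have cM l : l != i -> M l <= c l.
  move=> li; rewrite -[leLHS]add0r -(nu l li) -lerBrDr; apply: log_norm_leD => a.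
  by have := uM l li a; lra.
exists (fun l => c l - ((1 + q) * (\sum_(k | k != i) (c k - M k))
   - (c l - M l)) / (p l - 1)).
  have -> : wsum (fun l => c l - ((1 + q) * (\sum_(k | k != i) (c k - M k))
     - (c l - M l)) / (p l - 1)) =
     wsum M + \sum_(l | l != i) (p l - n * (1 + q)) * (c l - M l).
    set A := \sum_(k | k != i) (c k - M k).
    rewrite /wsum -big_split/=.
    have -> : \sum_(l | l != i) ((p l - 1) * M l
                 + (p l - n * (1 + q)) * (c l - M l)) =
      \sum_(l | l != i) ((p l * c l - M l) - n * (1 + q) * (c l - M l)).
      by apply: eq_bigr => l _; ring.
    rewrite sumrB -mulr_sumr -/A -card_off_i !mulr_suml.
    rewrite -sumrB; apply: eq_bigr => l _.
    by field; rewrite gt_eqF.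
  rewrite lerDl sumr_ge0// => l li.
  by rewrite mulr_ge0// subr_ge0 ?cM// p_ge.
move=> l li a.
have h : forall l, l != i -> forall a, u l a <= log_step u l a + (c l - M l).
  by move=> k ki b; rewrite /log_step -/c; have := uM k ki b; lra.
rewrite addrA lerBlDr; apply: le_trans (log_s_leD h li a).
by rewrite /log_step subrK.
Qed.

(** * Nonexpansiveness for Hilbert's projective distance in each block *)

Definition osc_le D u v := forall l, l != i ->
  exists c : R, forall a, v l a + c <= u l a <= v l a + c + D.

Lemma osc_le_trans D1 D2 u v x :
  osc_le D1 u v -> osc_le D2 v x -> osc_le (D1 + D2) u x.
Proof.
move=> uv vx l li; have [c hc] := uv l li; have [c' hc'] := vx l li.
exists (c + c') => a; have /andP[h1 h2] := hc a; have /andP[h3 h4] := hc' a.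
by apply/andP; split; lra.
Qed.

(** Two-sided use of [log_s_leD]: the shifts [c l] produce only a constant in each block, and the
    width [D] is multiplied by [(n * (1 + q) - 1) / (p l - 1)], at most 1 by the assumption on the
    exponents. Normalization merely changes the constants. *)
Lemma osc_le_step D u v : 0 <= D -> osc_le D u v -> osc_le D (log_step u) (log_step v).
Proof.
move=> D0 uv.
have [c hc] : {c : 'I_m -> R & forall l, l != i -> forall a,
    v l a + c l <= u l a <= v l a + c l + D}.
  apply: (@choice _ _ (fun l c => l != i -> forall a,
    v l a + c <= u l a <= v l a + c + D)) => l.
  by have [->|li] := eqVneq l i; [exists 0|have [c ?] := uv l li; exists c].
move=> l li.
have h1 : forall l, l != i -> forall a, u l a <= v l a + (c l + D).
  by move=> k ki a; have /andP[] := hc k ki a; lra.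
have h2 : forall l, l != i -> forall a, v l a <= u l a + (- c l).
  by move=> k ki a; have /andP[] := hc k ki a; lra.
exists (((1 + q) * (\sum_(k | k != i) c k) - c l) / (p l - 1)
    - log_norm (log_s u) l + log_norm (log_s v) l) => a.
have := log_s_leD h1 li a; have := log_s_leD h2 li a.
rewrite big_split/= sumrN /log_step.
have -> : \sum_(k | k != i) D = n * D.
  by rewrite -card_off_i mulr_suml; apply: eq_bigr => k _; rewrite mul1r.
set A := \sum_(k | k != i) c k.
have -> : ((1 + q) * (A + n * D) - (c l + D)) / (p l - 1) =
    ((1 + q) * A - c l) / (p l - 1) + (n * (1 + q) - 1) * D / (p l - 1) by ring.
have -> : ((1 + q) * - A - - c l) / (p l - 1) =
    - (((1 + q) * A - c l) / (p l - 1)) by ring.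
have : (n * (1 + q) - 1) * D / (p l - 1) <= D.
  by rewrite ler_pdivrMr// mulrC ler_wpM2l// lerD2r p_ge.
have arith (s t a' b X Y : R) : Y <= D -> t <= s + - X -> s <= t + (X + Y) ->
    t - b + (X - a' + b) <= s - a' <= t - b + (X - a' + b) + D.
  by move=> ? ? ?; apply/andP; split; lra.
exact: arith.
Qed.

(** [log_norm] is monotone and reproduces constants, so a normalized block lying in [[c, c + D]]
    forces [c <= 0 <= c + D]: oscillation then controls the sup norm. *)
Lemma normalized_osc D u : normalized u -> osc_le D u (fun _ _ => 0) ->
  forall l, l != i -> forall a, `|u l a| <= D.
Proof.
move=> nu ou l li a; have [c hc] := ou l li.
have c0 : c <= 0.
  rewrite -(nu l li) -[leLHS](log_norm_cst c l) -[leRHS]addr0.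
  by apply: log_norm_leD => b; have /andP[] := hc b; lra.
have cD : 0 <= c + D.
  rewrite -(nu l li) -[leRHS](log_norm_cst (c + D) l) -[leRHS]addr0.
  by apply: log_norm_leD => b; have /andP[] := hc b; lra.
by have /andP[] := hc a; rewrite ler_norml => ? ?; apply/andP; split; lra.
Qed.

Lemma osc_le0 D u : (forall l, l != i -> forall a, `|u l a| <= D / 2) ->
  osc_le D u (fun _ _ => 0).
Proof.
move=> uD l li; exists (- (D / 2)) => a.
by have := uD l li a; rewrite ler_norml => /andP[? ?]; apply/andP; split; lra.
Qed.

Lemma log_s_norm u e : 0 <= e ->
  (forall l, l != i -> forall a, `|u l a| <= e) ->
  forall l, l != i -> forall a, `|log_s u l a| <= e.
Proof.
move=> e0 ue l li a.
have s0 : log_s (fun _ _ => 0) l a = 0.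
  rewrite /log_s (_ : outer_log _ _ = fun=> 0) ?lav_cst ?mul0r//.
  apply: funext => j; rewrite /outer_log /logsum_but big1// add0r.
  rewrite /inner_log (_ : logsum _ = fun=> 0) ?lav_cst ?mulr0//.
  by apply: funext => j'; rewrite /logsum big1.
have se : ((1 + q) * (\sum_(k | k != i) e) - e) / (p l - 1) <= e.
  have -> : \sum_(k | k != i) e = n * e.
    by rewrite -card_off_i mulr_suml; apply: eq_bigr => k _; rewrite mul1r.
  rewrite ler_pdivrMr//.
  have := ler_wpM2l e0 (p_ge li); lra.
have h1 : forall l, l != i -> forall a, u l a <= 0 + e.
  by move=> k ki b; have := ue k ki b; rewrite ler_norml; lra.
have h2 : forall l, l != i -> forall a, 0 <= u l a + e.
  by move=> k ki b; have := ue k ki b; rewrite ler_norml; lra.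
have := log_s_leD h1 li a; have := log_s_leD (u := fun _ _ => 0) h2 li a.
rewrite s0 => lo up; rewrite ler_norml -sub0r lerBlDr.
rewrite (le_trans lo) ?lerD2l//= (le_trans up)// add0r.
exact: se.
Qed.

(** * The linearization at the fixed point and its quadratic form *)

Definition lin_inner u (b : 'I_(d i)) : R := av (wt i b) (logsum u).
Definition lin_outer u (l : 'I_m) (j : J) : R :=
  logsum_but l u j + q * lin_inner u (j i).
(** The derivative of [log_s] at [0], with [av] in place of [lav]. On centered states the
    normalization contributes only at second order, so there it is also the linearization of
    [log_step]. *)
Definition lin u : state := fun l a => av (wt l a) (lin_outer u l) / (p l - 1).
Arguments lin : clear implicits.

Definition ip u v : R :=
  \sum_(l | l != i) (p l - 1) * av rho (fun j => u l (j l) * v l (j l)).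
Definition hess u v : R := av rho (fun j => logsum u j * logsum v j
  - \sum_(l | l != i) u l (j l) * v l (j l)
  + q * (lin_inner u (j i) * lin_inner v (j i))).
Definition lincomb (t : R) u v : state := fun l a => u l a + t * v l a.
Arguments lincomb : clear implicits.
Definition centered u :=
  forall l, l != i -> av rho (fun j => u l (j l)) = 0.

(** The weights [p l - 1] cancel the divisions in [lin]. Summing [v_l] times the sum of the other
    blocks of [u] gives [logsum u * logsum v] minus the diagonal, and the tower property at slot [i]
    makes the remaining term symmetric. *)
Lemma ip_lin u v : ip (lin u) v = hess u v.
Proof.
have tow l : l != i ->
    (p l - 1) * av rho (fun j => lin u l (j l) * v l (j l)) =
    av rho (fun j => v l (j l) * lin_outer u l j).
  move=> li; rewrite -(av_tower (v l)) -avZ; apply: eq_av => j; rewrite /lin.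
  by field; rewrite gt_eqF.
have inner : av rho (fun j => lin_inner u (j i) * lin_inner v (j i)) =
    av rho (fun j => lin_inner u (j i) * logsum v j) by exact: av_tower.
rewrite /ip (eq_bigr _ tow) -av_sum /hess avD avZ inner -avZ -avD.
apply: eq_av => j; rewrite {2}/logsum mulr_sumr -sumrB.
rewrite {2}/logsum mulr_sumr mulr_sumr -big_split/=.
by apply: eq_bigr => l li; rewrite (logsumE _ _ li) /lin_outer; ring.
Qed.

Lemma logsum_lincomb t u v j :
  logsum (lincomb t u v) j = logsum u j + t * logsum v j.
Proof. by rewrite /logsum mulr_sumr -big_split. Qed.

Lemma lin_inner_lincomb t u v b :
  lin_inner (lincomb t u v) b = lin_inner u b + t * lin_inner v b.
Proof.
rewrite /lin_inner -avZ -avD; apply: eq_av => j; exact: logsum_lincomb.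
Qed.

Lemma hess_lincomb t u v : hess (lincomb t u v) (lincomb t u v) =
  hess u u + 2 * t * hess u v + t ^+ 2 * hess v v.
Proof.
rewrite /hess -!avZ -!avD; apply: eq_av => j.
rewrite !logsum_lincomb !lin_inner_lincomb.
have -> : \sum_(l | l != i) lincomb t u v l (j l) * lincomb t u v l (j l) =
    \sum_(l | l != i) u l (j l) * u l (j l)
    + 2 * t * (\sum_(l | l != i) u l (j l) * v l (j l))
    + t ^+ 2 * \sum_(l | l != i) v l (j l) * v l (j l).
  rewrite !mulr_sumr -!big_split/=; apply: eq_bigr => l _.
  by rewrite /lincomb; ring.
by ring.
Qed.

Lemma ip_lincomb t u v : ip (lincomb t u v) (lincomb t u v) =
  ip u u + 2 * t * ip u v + t ^+ 2 * ip v v.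
Proof.
rewrite /ip !mulr_sumr -!big_split/=; apply: eq_bigr => l _.
rewrite (_ : av _ _ = av rho (fun j => u l (j l) * u l (j l)
   + (2 * t * (u l (j l) * v l (j l)) + t ^+ 2 * (v l (j l) * v l (j l))))).
  by rewrite !avD !avZ; ring.
by apply: eq_av => j; rewrite /lincomb; ring.
Qed.

Lemma av_sqr_ge0 (w : J -> R) (h : J -> R) : prob w -> 0 <= av w (fun j => h j * h j).
Proof. by move=> pw; apply: av_ge_cst => // j; rewrite -expr2 sqr_ge0. Qed.

Lemma ip_ge0 u : 0 <= ip u u.
Proof. by apply: sumr_ge0 => l li; rewrite mulr_ge0 ?av_sqr_ge0// ltW. Qed.

Lemma lin_centered u : centered u -> centered (lin u).
Proof.
move=> cu l li.
have -> : av rho (fun j => lin u l (j l)) =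
    av rho (fun j => (p l - 1)^-1 * av (wt l (j l)) (lin_outer u l)).
  by apply: eq_av => j; rewrite mulrC.
rewrite (av_tower (fun=> _)) avZ avD avZ.
have -> : av rho (logsum_but l u) = 0.
  rewrite /logsum_but (av_sum _ _ (fun k (j : J) => u k (j k))) big1// => k /andP[ki _].
  exact: cu.
have -> : av rho (fun j => lin_inner u (j i)) =
   av rho (fun j => 1 * av (wt i (j i)) (logsum u)).
  by apply: eq_av => j; rewrite mul1r.
rewrite (av_tower (fun=> 1)).
have -> : av rho (fun j => 1 * logsum u j) = 0.
  rewrite avZ mul1r /logsum (av_sum _ _ (fun k (j : J) => u k (j k))) big1//.
by rewrite mulr0 addr0 mulr0.
Qed.

Hypothesis m_ge2 : (2 <= m)%N.

Let n_gt0 : 0 < n. Proof. by rewrite ltr0n subn_gt0. Qed.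

Lemma sqr_sum_le (x : 'I_m -> R) :
  (\sum_(l | l != i) x l) * (\sum_(l | l != i) x l) <=
  n * \sum_(l | l != i) x l * x l.
Proof.
set s := \sum_(l | l != i) x l; set a := \sum_(l | l != i) x l * x l.
have : 0 <= \sum_(l | l != i) (n * x l - s) ^+ 2.
  by apply: sumr_ge0 => l _; exact: sqr_ge0.
have -> : \sum_(l | l != i) (n * x l - s) ^+ 2 =
    n ^+ 2 * a - 2 * n * s * s + (\sum_(l | l != i) (1 : R)) * s ^+ 2.
  have -> : 2 * n * s * s = \sum_(l | l != i) 2 * n * s * x l.
    by rewrite -mulr_sumr.
  rewrite /a mulr_suml mulr_sumr -sumrB -big_split/=.
  by apply: eq_bigr => l _; ring.
rewrite card_off_i (_ : _ + _ = n * (n * a - s * s)); last by ring.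
by rewrite pmulr_rge0// subr_ge0.
Qed.

Definition energy u : R :=
  \sum_(l | l != i) av rho (fun j => u l (j l) * u l (j l)).
(** [lin_inner u b / n] is the conditional mean, given [j i = b], of the average of the [n] block
    values: it acts as a value of [u] at the eliminated vertex [b]. *)
Definition dirichlet u : R := \sum_(l | l != i)
  av rho (fun j => (u l (j l) - lin_inner u (j i) / n) ^+ 2).

Lemma dirichletE u : dirichlet u = energy u -
  av rho (fun j => lin_inner u (j i) * lin_inner u (j i)) / n.
Proof.
pose g (j : J) := lin_inner u (j i).
have gg : av rho (fun j => g j * g j) = av rho (fun j => g j * logsum u j).
  exact: av_tower.
have -> : dirichlet u = av rho (fun j => \sum_(l | l != i)
     (u l (j l) * u l (j l)) + ((- 2 / n) * (g j * logsum u j) + n^-1 * (g j * g j))).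
  rewrite /dirichlet -av_sum; apply: eq_av => j.
  rewrite -/(g j); move: (g j) => gj.
  have -> : n^-1 * (gj * gj) =
      (\sum_(l | l != i) (1 : R)) * (gj * gj / n ^+ 2).
    by rewrite card_off_i; field; rewrite gt_eqF.
  rewrite /logsum !mulr_sumr mulr_suml -!big_split/=; apply: eq_bigr => l _.
  by field; rewrite gt_eqF.
rewrite !avD !avZ av_sum -gg /energy -/(g _).
by field; rewrite gt_eqF.
Qed.

Lemma hessE u : hess u u = av rho (fun j => logsum u j * logsum u j)
  - energy u + q * av rho (fun j => lin_inner u (j i) * lin_inner u (j i)).
Proof. by rewrite /hess avD avZ avB av_sum. Qed.

(** Cauchy-Schwarz over the [n] blocks bounds the square of [logsum] by [n * energy], and
    [dirichletE] rewrites the slot-[i] term as [q * n * (energy - dirichlet)]. The total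
    [(n * (1 + q) - 1) * energy] is at most [ip u u] because of [p_ge]. *)
Lemma hess_le u : hess u u <= ip u u - q * n * dirichlet u.
Proof.
have h1 : (n * (1 + q) - 1) * energy u <= ip u u.
  rewrite /energy /ip mulr_sumr; apply: ler_sum => l li.
  by rewrite ler_wpM2r ?av_sqr_ge0// lerD2r p_ge.
have h2 : av rho (fun j => logsum u j * logsum u j) <= n * energy u.
  by rewrite /energy -av_sum -avZ; apply: av_le => // j; exact: sqr_sum_le.
rewrite hessE dirichletE.
set G := av rho (fun j => lin_inner u (j i) * lin_inner u (j i)).
rewrite (_ : q * n * (energy u - G / n) = q * n * energy u - q * G); last first.
  by field; rewrite gt_eqF.
move: h1 h2; move: (energy u) (ip u u) (av _ _) G => E I0 S G.
lra.
Qed.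

(** Only the diagonal term [- energy] is negative. For [m = 2] a single block is left and the square
    of [logsum] cancels it; for [m >= 3], [n >= 2] gives [p l - 1 >= 1 + 2 * q], so that [ip u u]
    dominates it with room to spare. *)
Lemma hess_ge u : - ((1 + 2 * q)^-1 * ip u u) <= hess u u.
Proof.
have e0 : 0 <= energy u by apply: sumr_ge0 => l _; exact: av_sqr_ge0.
have g0 : 0 <= q * av rho (fun j => lin_inner u (j i) * lin_inner u (j i)).
  by rewrite mulr_ge0 ?av_sqr_ge0// ltW.
have q2 : 0 < 1 + 2 * q by rewrite addr_gt0// mulr_gt0.
rewrite hessE; have [m2|m3] := leqP m 2.
  have -> : energy u = av rho (fun j => logsum u j * logsum u j).
    have m2' : m = 2%N by apply/eqP; rewrite eqn_leq m2 m_ge2.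
    rewrite /energy -av_sum; apply: eq_av => j.
    have [|l one] := @mem_card1 _ (predC1 i).
      by rewrite cardC1 card_ord m2'.
    have eqP k : (k != i) = (k == l) by have := one k; rewrite !inE.
    by rewrite /logsum !(eq_bigl _ _ eqP) !big_pred1_eq.
  rewrite subrr add0r (le_trans _ g0)// oppr_le0 mulr_ge0 ?ip_ge0// invr_ge0.
  exact: ltW.
have h1 : energy u <= (1 + 2 * q)^-1 * ip u u.
  rewrite ler_pdivlMl// /energy /ip mulr_sumr; apply: ler_sum => l li.
  rewrite ler_wpM2r ?av_sqr_ge0//; have := p_ge li.
  have : 2 <= n by rewrite ler_nat leq_subRL// (leq_trans _ m3).
  have q1 : 0 <= 1 + q by rewrite addr_ge0// ltW.
  move=> n2; have := ler_wpM2r q1 n2; lra.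
have s0 : 0 <= av rho (fun j => logsum u j * logsum u j) by exact: av_sqr_ge0.
move: s0 g0 h1; move: (q * _) (energy u) (_^-1 * _) => G E I0.
by move: (av _ _) => S; lra.
Qed.

(** * Poincare inequality and spectral gap *)

Hypothesis irr : weakly_irreducible rho.

(* Slot [i] is filled so that [dirichlet] controls all differences of [ext]
   across edges of the graph. *)
Definition ext u : state := @upd R m d u i (fun b => lin_inner u b / n).
Arguments ext : clear implicits.

Lemma ext_in u b : ext u i b = lin_inner u b / n.
Proof. by rewrite /ext /upd dfwithin. Qed.

Lemma ext_out u l a : l != i -> ext u l a = u l a.
Proof. by move=> li; rewrite /ext /upd dfwithout// eq_sym. Qed.

Lemma dirichlet_ge0 u : 0 <= dirichlet u.
Proof.
by apply: sumr_ge0 => l _; apply: av_ge_cst => // j; exact: sqr_ge0.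
Qed.

Lemma av_ge_term (h : J -> R) j : (forall j, 0 <= h j) -> rho j * h j <= av rho h.
Proof.
move=> h0; rewrite /av (bigD1 j)//= lerDl sumr_ge0// => k _.
by rewrite mulr_ge0.
Qed.

Lemma dirichlet_ge_term u j k :
  rho j * (ext u k (j k) - lin_inner u (j i) / n) ^+ 2 <= dirichlet u.
Proof.
have [->|ki] := eqVneq k i.
  by rewrite ext_in subrr expr0n mulr0 dirichlet_ge0.
rewrite ext_out// /dirichlet (bigD1 k)//=.
rewrite ler_wpDr//.
  by apply: sumr_ge0 => l _; apply: av_ge_cst => // j'; exact: sqr_ge0.
apply: (@av_ge_term (fun j => (u k (j k) - lin_inner u (j i) / n) ^+ 2)) => j'.
exact: sqr_ge0.
Qed.

(** Induction along a path: the endpoints of an edge lie on a common multi-index [j] with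
    [rho j > 0], and both values of [ext u] are close to the value at the vertex [j i]. *)
Lemma dirichlet_ge_diff (x y : vert d) : exists2 C : R, 0 <= C &
  forall u, (ext u (tag x) (tagged x) - ext u (tag y) (tagged y)) ^+ 2
    <= C * dirichlet u.
Proof.
have /connectP[s ps ->] := irr x y.
elim: s x ps => [|z s IH] x /=.
  by exists 0 => // u; rewrite subrr expr0n mul0r.
move=> /andP[/andP[_ /existsP[j /and3P[/eqP jx /eqP jz r0]]] /IH[C C0 hC]].
(* Two deviations of square at most [A] differ by a square of at most [4 * A]; joining the edge to
   the rest of the path doubles both contributions. *)
exists (8 / rho j + 2 * C).
  by rewrite addr_ge0 ?mulr_ge0 ?invr_ge0.
move=> u; have := hC u.
have edge k : (ext u k (j k) - lin_inner u (j i) / n) ^+ 2 <= dirichlet u / rho j.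
  by rewrite ler_pdivlMr// mulrC dirichlet_ge_term.
have := edge (tag z); have := edge (tag x); rewrite jx jz.
rewrite (_ : (8 / rho j + 2 * C) * dirichlet u =
   8 * (dirichlet u / rho j) + 2 * (C * dirichlet u)); last by ring.
have arith (X Z Y G A B : R) : (X - G) ^+ 2 <= A -> (Z - G) ^+ 2 <= A ->
    (Z - Y) ^+ 2 <= B -> (X - Y) ^+ 2 <= 8 * A + 2 * B.
  move=> h1 h2 h3; have a1 := sqr_ge0 (X - G + (Z - G)).
  by have a2 := sqr_ge0 (X - Z - (Z - Y)); nra.
exact: arith.
Qed.

Lemma sqr_av_le (w h : J -> R) : prob w -> av w h * av w h <= av w (fun j => h j * h j).
Proof.
move=> pw; rewrite -subr_ge0.
have -> : av w (fun j => h j * h j) - av w h * av w h =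
    av w (fun j => (h j - av w h) * (h j - av w h)).
  have -> : av w (fun j => (h j - av w h) * (h j - av w h)) =
      av w (fun j => h j * h j + (- 2 * av w h) * h j + av w h * av w h).
    by apply: eq_av => j; ring.
  by rewrite !avD (avZ _ (- 2 * av w h)) av_cst//; ring.
exact: av_sqr_ge0.
Qed.

(** A centered entry is the mean of its differences from the entries of its own block; Jensen's
    inequality reduces its square to squared differences, controlled along paths. A sum over all
    pairs of vertices serves as a common constant. *)
Lemma poincare : exists2 K : R, 0 < K & forall u, centered u ->
  forall l, l != i -> forall a, u l a * u l a <= K * dirichlet u.
Proof.
have [C hC] : {C : vert d * vert d -> R & forall z, 0 <= C z /\ forall u,
    (ext u (tag z.1) (tagged z.1) - ext u (tag z.2) (tagged z.2)) ^+ 2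
    <= C z * dirichlet u}.
  apply: (@choice _ _ (fun z c => 0 <= c /\ forall u,
    (ext u (tag z.1) (tagged z.1) - ext u (tag z.2) (tagged z.2)) ^+ 2
    <= c * dirichlet u)) => z.
  by have [c ? ?] := dirichlet_ge_diff z.1 z.2; exists c.
have C0 : 0 <= \sum_z C z by apply: sumr_ge0 => z _; have [] := hC z.
exists (1 + \sum_z C z); first by rewrite ltr_wpDr.
move=> u cu l li a.
have -> : u l a = av rho (fun j => u l a - u l (j l)).
  by rewrite avB av_cst// cu// subr0.
apply: le_trans (sqr_av_le _ rho_prob) _; apply: av_le_cst => // j.
pose x : vert d := Tagged _ a; pose y : vert d := Tagged _ (j l).
have [_ /(_ u)] := hC (x, y); rewrite /= !ext_out// -expr2 => /le_trans; apply.
rewrite ler_wpM2r ?dirichlet_ge0// (bigD1 (x, y))//= addrCA lerDl addr_ge0//.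
by apply: sumr_ge0 => z _; have [] := hC z.
Qed.

Let pmass : R := 1 + \sum_(l | l != i) (p l - 1).
Let pmass_gt0 : 0 < pmass.
Proof. by rewrite ltr_wpDr// sumr_ge0// => l _; rewrite ltW. Qed.

Lemma ip_le u (c : R) : 0 <= c ->
  (forall l, l != i -> forall a, u l a * u l a <= c) -> ip u u <= pmass * c.
Proof.
move=> c0 uc; rewrite /pmass mulrDl mul1r ler_wpDl// mulr_suml.
apply: ler_sum => l li; rewrite ler_pM2l//.
by apply: av_le_cst => // j; exact: uc.
Qed.

Lemma hess_gap : exists2 nu : R, 0 < nu < 1 &
  forall u, centered u -> `|hess u u| <= nu * ip u u.
Proof.
have [K K0 hK] := poincare.
have q2 : 0 < 1 + 2 * q by rewrite addr_gt0// mulr_gt0.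
have PK : 0 < pmass * K by rewrite mulr_gt0.
(* The first entry comes from [hess_le] and the Poincare inequality, the second from [hess_ge]. *)
exists (Num.max (1 - q * n / (pmass * K)) (1 + 2 * q)^-1).
  rewrite lt_max invr_gt0 q2 orbT gt_max invf_lt1// ltrDl mulr_gt0//.
  by rewrite andbT ltrBlDr ltrDl divr_gt0// mulr_gt0.
move=> u cu; have i0 := ip_ge0 u.
rewrite ler_norml; apply/andP; split.
  apply: le_trans (hess_ge u); rewrite lerN2 ler_wpM2r// le_max lexx orbT//.
apply: le_trans (hess_le u) _.
apply: (@le_trans _ _ ((1 - q * n / (pmass * K)) * ip u u)); last first.
  by rewrite ler_wpM2r// le_max lexx.
have : ip u u <= pmass * (K * dirichlet u).
  by apply: ip_le; [rewrite mulr_ge0 ?dirichlet_ge0// ltW|exact: hK].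
rewrite mulrA mulrC -ler_pdivrMr// => h.
rewrite mulrBl mul1r lerD2l lerN2.
rewrite (_ : _ / _ * _ = q * n * (ip u u / (pmass * K))); last by ring.
rewrite ler_wpM2l//.
by rewrite mulr_ge0// ltW.
Qed.

(* A symmetric operator is bounded by the numerical range of its form:
   polarize [hess] at [u +- nu^-1 lin u]. *)
Lemma lin_contract : exists2 nu : R, 0 < nu < 1 &
  forall u, centered u -> ip (lin u) (lin u) <= nu ^+ 2 * ip u u.
Proof.
have [nu /andP[nu0 nu1] hnu] := hess_gap; exists nu; first by rewrite nu0.
move=> u cu; have lu := lin_centered cu.
have cc t : centered (lincomb t u (lin u)).
  by move=> l li; rewrite /lincomb avD avZ cu// lu// mulr0 addr0.
have := hnu _ (cc nu^-1); have := hnu _ (cc (- nu^-1)).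
rewrite !ler_norml !hess_lincomb !ip_lincomb -(ip_lin u (lin u)) sqrrN.
move: (ip (lin u) (lin u)) (ip u u) (ip u (lin u)) (hess u u) (hess (lin u) (lin u)).
move=> X Y Z H H' /andP[h1 _] /andP[_ h2].
have e1 : nu * (nu^-1 ^+ 2 * X) = nu^-1 * X by field; rewrite gt_eqF.
have : 4 * (nu^-1 * X) <= 2 * (nu * Y) + 2 * (nu^-1 * X).
  by rewrite -e1; lra.
have -> : nu ^+ 2 * Y = nu * (nu * Y) by ring.
by rewrite -ler_pdivrMl// => ?; lra.
Qed.

(** * The Hilbert norm and its equivalence with the sup norm *)

Definition wnorm u : R := Num.sqrt (ip u u).

Lemma wnorm_ge0 u : 0 <= wnorm u. Proof. exact: sqrtr_ge0. Qed.

Lemma sqr_wnorm u : wnorm u ^+ 2 = ip u u.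
Proof. by rewrite sqr_sqrtr// ip_ge0. Qed.

Lemma wnorm_le_sup : exists2 C : R, 0 < C & forall u e, 0 <= e ->
  (forall l, l != i -> forall a, `|u l a| <= e) -> wnorm u <= C * e.
Proof.
exists (Num.sqrt pmass) => [|u e e0 ue]; first by rewrite sqrtr_gt0.
rewrite /wnorm -(ger0_norm e0) -sqrtr_sqr -sqrtrM ?(ltW pmass_gt0)// ler_sqrt; last first.
  by rewrite mulr_ge0 ?sqr_ge0// ltW.
apply: ip_le => [|l li a]; first exact: sqr_ge0.
by rewrite -expr2 -real_normK ?num_real// lerXn2r ?nnegrE ?ue.
Qed.

Lemma sup_le_wnorm : exists2 C : R, 0 < C & forall u l, l != i ->
  forall a, `|u l a| <= C * wnorm u.
Proof.
pose c (x : vert d) : R := ((p (tag x) - 1) * mu (tag x) (tagged x))^-1.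
have c0 (x : vert d) : 0 <= c x by rewrite invr_ge0 mulr_ge0 ?ltW.
(* The sum stands in for a maximum; the leading 1 gives [C <= C ^+ 2], so that [C] may be moved
   under the square root. *)
exists (1 + \sum_(x : vert d) c x); first by rewrite ltr_wpDr// sumr_ge0.
move=> u l li a; set C := 1 + _.
have C1 : 1 <= C by rewrite lerDl sumr_ge0.
have C0 : 0 <= C by rewrite (le_trans _ C1).
pose x : vert d := Tagged _ a.
have cC : c x <= C by rewrite /C (bigD1 x)//= addrCA lerDl addr_ge0// sumr_ge0.
rewrite /wnorm -sqrtr_sqr -(ger0_norm C0) -[`|C|]sqrtr_sqr -sqrtrM ?sqr_ge0//.
rewrite ler_sqrt; last by rewrite mulr_ge0 ?sqr_ge0 ?ip_ge0.
have h : (p l - 1) * mu l a * u l a ^+ 2 <= ip u u.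
  rewrite /ip (bigD1 l)//= ler_wpDr//.
    by apply: sumr_ge0 => k _; rewrite mulr_ge0 ?av_sqr_ge0// ltW.
  rewrite -mulrA ler_pM2l// /mu /av mulr_suml big_mkcond/=.
  apply: ler_sum => j _; case: ifP => [/eqP ->|_]; first by rewrite expr2.
  by rewrite mulr_ge0// -expr2 sqr_ge0.
apply: (@le_trans _ _ (c x * ip u u)).
  by rewrite /c/= ler_pdivlMl// mulr_gt0.
rewrite ler_wpM2r ?ip_ge0// (le_trans cC)// expr2 ler_peMr//.
Qed.

Lemma ipC u v : ip u v = ip v u.
Proof.
by apply: eq_bigr => l _; congr (_ * _); apply: eq_av => j; rewrite mulrC.
Qed.

Lemma ip_le_wnorm u v : ip u v <= wnorm u * wnorm v.
Proof.
have zero x y : wnorm x = 0 -> ip x y = 0.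
  move=> x0; have [C _ hC] := sup_le_wnorm.
  apply: big1 => l li; rewrite (_ : av _ _ = 0) ?mulr0//.
  rewrite /av big1// => j _; have := hC x l li (j l).
  by rewrite x0 mulr0 normr_le0 => /eqP ->; rewrite mul0r mulr0.
have [u0|u0] := eqVneq (wnorm u) 0; first by rewrite zero// u0 mul0r.
have [v0|v0] := eqVneq (wnorm v) 0; first by rewrite ipC zero// v0 mulr0.
have {}u0 : 0 < wnorm u by rewrite lt_neqAle eq_sym u0 wnorm_ge0.
have {}v0 : 0 < wnorm v by rewrite lt_neqAle eq_sym v0 wnorm_ge0.
have := ip_ge0 (lincomb (- (wnorm u / wnorm v)) u v).
rewrite ip_lincomb -!sqr_wnorm.
rewrite (_ : _ + _ = (2 * wnorm u / wnorm v) * (wnorm u * wnorm v - ip u v)).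
  by rewrite pmulr_rge0 ?subr_ge0// divr_gt0// mulr_gt0.
by field; rewrite gt_eqF.
Qed.

Lemma wnormD u v : wnorm (add_state u v) <= wnorm u + wnorm v.
Proof.
have -> : add_state u v = lincomb 1 u v.
  by rewrite /add_state /lincomb; apply: functional_extensionality_dep => l;
     apply: funext => a; rewrite mul1r.
rewrite -(ler_pXn2r (n := 2))// ?nnegrE ?addr_ge0 ?wnorm_ge0//.
rewrite sqr_wnorm ip_lincomb -!sqr_wnorm.
have := ip_le_wnorm u v; lra.
Qed.

Lemma wnormZ (t : R) u : wnorm (scale_state t u) = `|t| * wnorm u.
Proof.
rewrite /wnorm -sqrtr_sqr -sqrtrM ?sqr_ge0//; congr Num.sqrt.
rewrite /ip mulr_sumr; apply: eq_bigr => l _.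
rewrite [RHS]mulrCA; congr (_ * _); rewrite -avZ; apply: eq_av => j.
by rewrite /scale_state; ring.
Qed.

Lemma wnorm_le u v : (forall l, l != i -> forall a, `|u l a| <= `|v l a|) ->
  wnorm u <= wnorm v.
Proof.
move=> uv; rewrite /wnorm ler_sqrt ?ip_ge0//; apply: ler_sum => l li.
rewrite ler_pM2l//; apply: av_le => // j.
by rewrite -!expr2 -[leLHS]real_normK ?num_real// -[leRHS]real_normK ?num_real//
  lerXn2r ?nnegrE ?uv.
Qed.

(** * Second-order error and local contraction *)

Lemma log_step_shift u v :
  (forall l, l != i -> exists c, forall a, u l a = v l a + c) ->
  forall l, l != i -> forall a, log_step u l a = log_step v l a.
Proof.
move=> uv; have h : osc_le 0 u v.
  by move=> l li; have [c hc] := uv l li; exists c => a; rewrite hc addr0 lexx.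
move=> l li a; have [c hc] := osc_le_step (lexx 0) h li.
have eqc b : log_step u l b = log_step v l b + c.
  by apply/le_anti/andP; have := hc b; rewrite addr0 => /andP[].
have c0 : 0 <= c.
  rewrite -(log_step_normalized u li) -[leRHS]add0r -(log_step_normalized v li).
  by apply: log_norm_leD => b; rewrite eqc.
have c1 : 0 <= - c.
  rewrite -(log_step_normalized v li) -[leRHS]add0r -(log_step_normalized u li).
  by apply: log_norm_leD => b; rewrite eqc addrK.
rewrite eqc (_ : c = 0) ?addr0//.
by apply/le_anti; rewrite -oppr_ge0 c1.
Qed.

Lemma sum_norm_le (P : pred 'I_m) u e j : 0 <= e ->
  (forall k, P k -> k != i) ->
  (forall l, l != i -> forall a, `|u l a| <= e) ->
  `|\sum_(k | P k) u k (j k)| <= n * e.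
Proof.
move=> e0 Pi ue; apply: le_trans (ler_norm_sum _ _ _) _.
rewrite -card_off_i mulr_suml big_mkcond [leRHS]big_mkcond; apply: ler_sum => k _.
have [/Pi ki|_] := boolP (P k); first by rewrite ki mul1r ue.
by case: ifP; rewrite // mul1r.
Qed.

Lemma log_s_quad u e l a : 0 <= e -> n * (1 + q) * e <= 2^-1 -> l != i ->
  (forall l, l != i -> forall a, `|u l a| <= e) ->
  lin u l a <= log_s u l a <=
  lin u l a + (2 * q * n ^+ 2 + 2 * (n * (1 + q)) ^+ 2) / (p l - 1) * e ^+ 2.
Proof.
move=> e0 eK li ue.
have ne0 : 0 <= n * e by rewrite mulr_ge0// ltW.
have neK : n * e <= n * (1 + q) * e by rewrite ler_wpM2r// ler_peMr// ?lerDl ltW.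
have Sn j : `|logsum u j| <= n * e by exact: sum_norm_le.
have in1 b : lin_inner u b <= inner_log u b by exact: lav_ge.
have in2 b : inner_log u b <= lin_inner u b + 2 * (n * e) ^+ 2.
  by apply: lav_le_quad => //; exact: le_trans eK.
have on j : `|outer_log u l j| <= n * (1 + q) * e.
  rewrite /outer_log (le_trans (ler_normD _ _))//.
  rewrite (_ : n * (1 + q) * e = n * e + q * (n * e)); last by ring.
  rewrite lerD//; first by apply: sum_norm_le => // k /andP[].
  rewrite normrM gtr0_norm// ler_pM2l//; exact: lav_norm.
have o1 j : lin_outer u l j <= outer_log u l j.
  by rewrite /lin_outer /outer_log lerD2l ler_pM2l.
have o2 j : outer_log u l j <= lin_outer u l j + q * (2 * (n * e) ^+ 2).
  by rewrite /lin_outer /outer_log -addrA lerD2l -mulrDr ler_pM2l.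
rewrite /lin /log_s; apply/andP; split.
  rewrite ler_pM2r ?invr_gt0//; apply: le_trans (lav_ge _ _) => //.
  exact: av_le.
rewrite mulrAC -mulrDl ler_pM2r ?invr_gt0//.
apply: le_trans (lav_le_quad _ eK on) _ => //.
have h : av (wt l a) (outer_log u l) <=
    av (wt l a) (lin_outer u l) + q * (2 * (n * e) ^+ 2).
  rewrite -[X in _ <= _ + X](av_cst (prob_wt a)) -avD.
  exact: av_le.
apply: le_trans (lerD h (lexx _)) _; rewrite le_eqVlt; apply/orP; left.
by apply/eqP; ring.
Qed.

Lemma log_step_quad : exists C e0 : R, [/\ 0 < C, 0 < e0 & forall u e,
  0 <= e <= e0 -> centered u -> (forall l, l != i -> forall a, `|u l a| <= e) ->
  forall l, l != i -> forall a, `|log_step u l a - lin u l a| <= C * e ^+ 2].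
Proof.
pose A := 2 * q * n ^+ 2 + 2 * (n * (1 + q)) ^+ 2.
have A0 : 0 <= A.
  have q0 := ltW q_gt0.
  by apply: addr_ge0; rewrite mulr_ge0 ?sqr_ge0// mulr_ge0.
(* [e <= (2 * W)^-1] keeps both [n * (1 + q) * e] and [p l * e] below 1/2, the range in which
   [lav_le_quad] applies to [log_s] and to [log_norm]. *)
pose W := 1 + n * (1 + q) + \sum_l p l.
have K0 : 0 <= n * (1 + q) by rewrite mulr_ge0 ?addr_ge0// ltW.
have P0 : 0 <= \sum_l p l by apply: sumr_ge0 => l _; rewrite ltW.
have W0 : 0 < W by rewrite /W -addrA ltr_wpDr// addr_ge0.
pose F l := A / (p l - 1) + 2 * p l.
have F0 l : 0 <= F l by rewrite addr_ge0// ?mulr_ge0 ?invr_ge0// ltW.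
exists (1 + \sum_l F l), (2 * W)^-1; split.
- by rewrite ltr_wpDr// sumr_ge0.
- by rewrite invr_gt0 mulr_gt0.
move=> u e /andP[e0 eW] cu ue l li a.
have We : W * e <= 2^-1.
  by move: eW; rewrite invfM -ler_pdivlMl// mulrC.
have Ke : n * (1 + q) * e <= 2^-1.
  apply: le_trans We; rewrite ler_wpM2r// /W addrAC lerDr addr_ge0//.
have pe : p l * e <= 2^-1.
  apply: le_trans We; rewrite ler_wpM2r// /W (bigD1 l)//= addrCA lerDl.
  by rewrite !addr_ge0// sumr_ge0// => k _; rewrite ltW.
set B := A / (p l - 1) * e ^+ 2.
have sq b : lin u l b <= log_s u l b <= lin u l b + B by exact: log_s_quad.
have lc : av rho (fun j => lin u l (j l)) = 0 by exact: lin_centered.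
have n1 : 0 <= log_norm (log_s u) l.
  rewrite /log_norm divr_ge0// ?(ltW (p_gt0 l))//; apply: le_trans (lav_ge _ _) => //.
  rewrite avZ mulr_ge0 ?(ltW (p_gt0 l))// -lc; apply: av_le => // j.
  by have /andP[] := sq (j l).
have n2 : log_norm (log_s u) l <= B + 2 * p l * e ^+ 2.
  rewrite /log_norm ler_pdivrMr//.
  have hp j : `|p l * log_s u l ((j : J) l)| <= p l * e.
    by rewrite normrM gtr0_norm// ler_pM2l//; exact: log_s_norm.
  apply: le_trans (lav_le_quad _ pe hp) _ => //.
  rewrite avZ [leRHS]mulrDl lerD//.
    rewrite mulrC ler_pM2r// -[leRHS]add0r -lc -[X in _ <= _ + X](av_cst rho_prob).
    by rewrite -avD; apply: av_le => // j; have /andP[] := sq (j l).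
  by rewrite le_eqVlt; apply/orP; left; apply/eqP; ring.
have arith (s t c b r : R) : 0 <= r -> t <= s <= t + b -> 0 <= c -> c <= b + r ->
    `|s - c - t| <= b + r.
  by move=> ? /andP[? ?] ? ?; rewrite ler_norml; apply/andP; split; lra.
apply: le_trans (arith _ _ _ _ _ _ (sq a) n1 n2) _.
  by rewrite mulr_ge0 ?sqr_ge0// mulr_ge0// ltW.
rewrite /B -mulrDl ler_wpM2r ?sqr_ge0// -/(F l) (bigD1 l)//= addrCA lerDl.
by rewrite addr_ge0// sumr_ge0.
Qed.

(** Centering is an orthogonal projection, hence does not increase [wnorm], and [log_step] does not
    see it. On the centered point [lin] contracts by [nu], and the quadratic error uses up half of
    the gap [1 - nu]. *)
Lemma local_contraction : exists nu e : R, [/\ 0 < nu, nu < 1, 0 < e &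
  forall u, (forall l, l != i -> forall a, `|u l a| <= e) ->
  wnorm (log_step u) <= nu * wnorm u].
Proof.
have [nu /andP[nu0 nu1] hnu] := lin_contract.
have [C1 C1p hC1] := wnorm_le_sup; have [C2 C2p hC2] := sup_le_wnorm.
have [C [e0 [Cp e0p hC]]] := log_step_quad.
(* The first entry brings the sup bound recovered from [wnorm] below [e0]; the second makes the
   quadratic error at most [(1 - nu) / 2 * wnorm v]. *)
pose e1 := Num.min (e0 / (C1 * C2)) ((1 - nu) / 2 / (C1 * C * C2 ^+ 2 * C1)).
have e1p : 0 < e1.
  by rewrite lt_min !divr_gt0// ?subr_gt0// !mulr_gt0// exprn_gt0.
exists ((1 + nu) / 2), e1; split=> //; [lra|lra|].
move=> u ue.
pose v : state := fun l a => u l a - av rho (fun j => u l (j l)).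
have vE l a : v l a = u l a - av rho (fun j => u l (j l)) by [].
have cv : centered v by move=> l li; rewrite /v avB av_cst// subrr.
have vu : wnorm v <= wnorm u.
  rewrite /wnorm ler_sqrt ?ip_ge0//; apply: ler_sum => l li; rewrite ler_pM2l//.
  set c := av rho (fun j => u l (j l)).
  have -> : av rho (fun j => v l (j l) * v l (j l)) =
     av rho (fun j => u l (j l) * u l (j l) + ((- 2 * c) * u l (j l) + c * c)).
    by apply: eq_av => j; rewrite !vE -/c; ring.
  rewrite avD avD (avZ _ (- 2 * c)) av_cst// -/c.
  by have := sqr_ge0 c; lra.
set e := C2 * wnorm v.
have ee : e <= C2 * C1 * e1.
  rewrite -mulrA ler_pM2l// (le_trans vu)//.
  by apply: hC1 => //; exact: ltW.
have e00 : 0 <= e by rewrite mulr_ge0 ?wnorm_ge0// ltW.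
have ele : e <= e0.
  apply: (le_trans ee).
  rewrite (_ : C2 * C1 = C1 * C2) ?[C2 * _]mulrC// -ler_pdivlMl ?mulr_gt0//.
  by rewrite mulrC ge_min lexx.
have err : wnorm (sub_state (log_step v) (lin v)) <= (1 - nu) / 2 * wnorm v.
  apply: (@le_trans _ _ (C1 * (C * e ^+ 2))).
    apply: hC1 => [|l li a]; first by rewrite mulr_ge0 ?sqr_ge0// ltW.
    by apply: hC => //; [rewrite e00|move=> k ki b; exact: hC2].
  apply: (@le_trans _ _ (C1 * C * C2 ^+ 2 * C1 * e1 * wnorm v)).
    rewrite (_ : C1 * C * C2 ^+ 2 * C1 * e1 * wnorm v =
      C1 * (C * (e * (C2 * C1 * e1)))); last by rewrite /e; ring.
    by rewrite expr2 ler_pM2l// ler_pM2l// ler_wpM2l.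
  rewrite ler_wpM2r ?wnorm_ge0// mulrC -ler_pdivlMr; last first.
    by rewrite !mulr_gt0// exprn_gt0.
  by rewrite ge_min lexx orbT.
have lv : wnorm (lin v) <= nu * wnorm v.
  rewrite -(ler_pXn2r (n := 2))// ?nnegrE ?mulr_ge0 ?wnorm_ge0 ?(ltW nu0)//.
  by rewrite exprMn !sqr_wnorm hnu.
have -> : (1 + nu) / 2 * wnorm u =
    nu * wnorm u + (1 - nu) / 2 * wnorm u by field.
apply: (@le_trans _ _ (nu * wnorm v + (1 - nu) / 2 * wnorm v)); last first.
  rewrite -!mulrDl ler_wpM2l//; lra.
apply: le_trans (lerD lv err); apply: le_trans (wnormD _ _).
apply: wnorm_le => l li a; rewrite /add_state /sub_state addrC subrK.
rewrite (@log_step_shift u v)// => k ki.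
by exists (av rho (fun j => u k (j k))) => b; rewrite vE subrK.
Qed.

(** * Convergence of the iterates from every starting point *)

Definition tends0 (U : nat -> state) := forall e, 0 < e ->
  exists N : nat, forall k, (N <= k)%N ->
    forall l, l != i -> forall a, `|U k l a| <= e.

Lemma osc_le_step0 D u : 0 <= D -> osc_le D u (fun _ _ => 0) ->
  osc_le D (log_step u) (fun _ _ => 0).
Proof.
move=> D0 uD; rewrite -[D]addr0; apply: osc_le_trans (osc_le_step D0 uD) _.
move=> l li; exists (- log_norm (log_s (fun _ _ => 0)) l) => a.
have : `|log_s (fun _ _ => 0) l a| <= 0.
  by apply: log_s_norm => // k ki b; rewrite normr0.
by rewrite normr_le0 /log_step => /eqP ->; rewrite add0r addr0 lexx.
Qed.

Lemma iter_local : exists2 e : R, 0 < e & forall u, osc_le e u (fun _ _ => 0) ->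
  tends0 (fun k => iter k log_step u).
Proof.
have [nu [e [nu0 nu1 e0 contr]]] := local_contraction.
have [C C0 hC] := sup_le_wnorm.
exists e => // u ue eps eps0.
have osc k : osc_le e (iter k log_step u) (fun _ _ => 0).
  by elim: k => // k IH; rewrite iterS; apply: osc_le_step0 => //; exact: ltW.
(* The starting point need not be normalized, so smallness in the sup norm, and with it the
   geometric decay, begins only after one step. *)
have small k : forall l, l != i -> forall a, `|iter k.+1 log_step u l a| <= e.
  by apply: normalized_osc; [exact: log_step_normalized|exact: osc].
have geom k : wnorm (iter k.+1 log_step u) <= nu ^+ k * wnorm (log_step u).
  elim: k => [|k IH]; first by rewrite expr0 mul1r.
  apply: le_trans (contr _ (small k)) _.
  by rewrite exprS -mulrA ler_pM2l.
have B0 : 0 < C * wnorm (log_step u) + 1.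
  by rewrite ltr_wpDl// mulr_ge0 ?wnorm_ge0// ltW.
have /cvgrPdist_lt/(_ (eps / (C * wnorm (log_step u) + 1))) :
    (GRing.exp nu : nat -> R) @ \oo --> (0 : R).
  by apply: cvg_expr; rewrite ger0_norm// ltW.
rewrite divr_gt0// => /(_ isT)[N _ hN]; exists N.+1 => -[//|k] Nk l li a.
apply: le_trans (hC _ l li a) _.
apply: (@le_trans _ _ (C * (nu ^+ k * wnorm (log_step u)))).
  by rewrite ler_pM2l.
have := hN k Nk; rewrite /= sub0r normrN ger0_norm; last by rewrite exprn_ge0// ltW.
move/ltW => hk; rewrite mulrCA.
apply: (@le_trans _ _ (nu ^+ k * (C * wnorm (log_step u) + 1))).
  by rewrite ler_wpM2l ?exprn_ge0 ?(ltW nu0)// lerDl.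
by rewrite -ler_pdivlMr.
Qed.

(* Walk from [0] to [u] along the segment in steps short enough for the basin of
   [iter_local]: nonexpansiveness propagates convergence from one point to the
   next. *)
Lemma iter_global u : tends0 (fun k => iter k log_step u).
Proof.
have [e e0 loc] := iter_local.
pose B : R := \sum_(x : vert d) `|u (tag x) (tagged x)|.
have uB l a : `|u l a| <= B.
  pose x : vert d := Tagged _ a.
  by rewrite /B (bigD1 x)//= lerDl sumr_ge0.
have B0 : 0 <= B by exact: sumr_ge0.
(* The radius [e] is spent in halves: one on a hop of oscillation [2 * (B / M)], the other on the
   distance from [0] of an iterate of the previous point. *)
pose M := (Num.trunc (4 * B / e)).+1.
have M0 : 0 < M%:R :> R by rewrite ltr0n.
have BM : 2 * (B / M%:R) <= e / 2.
  have : 4 * B / e <= M%:R by exact/ltW/truncnS_gt.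
  rewrite ler_pdivrMr// mulrA ler_pdivrMr// => ?; lra.
pose w (s : nat) : state := fun l a => s%:R / M%:R * u l a.
have ww s : osc_le (e / 2) (w s.+1) (w s).
  move=> l li; exists (- (B / M%:R)) => a.
  have -> : w s.+1 l a = w s l a + u l a / M%:R by rewrite /w -natr1; ring.
  have := uB l a; rewrite ler_norml => /andP[h1 h2].
  have k1 : - (B / M%:R) <= u l a / M%:R by rewrite -mulNr ler_pM2r ?invr_gt0.
  have k2 : u l a / M%:R <= B / M%:R by rewrite ler_pM2r ?invr_gt0.
  move: (w s l a) (u l a / _) (B / _) k1 k2 BM => ? ? ? ? ? ?.
  by apply/andP; split; lra.
have e20 : 0 <= e / 2 by rewrite divr_ge0// ltW.
have conv s : tends0 (fun k => iter k log_step (w s)).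
  elim: s => [|s IH].
    apply: loc; apply: osc_le0 => l li a.
    by rewrite /w mul0r mul0r normr0.
  have [|N hN] := IH (e / 4); first by rewrite divr_gt0.
  have near0 : osc_le (e / 2) (iter N log_step (w s)) (fun _ _ => 0).
    apply: osc_le0 => l li a; have := hN N (leqnn N) l li a.
    move/le_trans; apply; lra.
  have : osc_le (e / 2) (iter N log_step (w s.+1)) (iter N log_step (w s)).
    by elim: N {hN near0} => [|N IHN]; [exact: ww|rewrite !iterS; exact: osc_le_step].
  move=> /osc_le_trans/(_ near0); rewrite -splitr => /loc lim eps eps0.
  have [N' hN'] := lim _ eps0; exists (N' + N)%N => k Nk l li a.
  have NK : (N <= k)%N := leq_trans (leq_addl _ _) Nk.
  have Nk' : (N' <= k - N)%N by rewrite leq_subRL// addnC.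
  by have := hN' _ Nk' l li a; rewrite -iterD subnK.
have -> : u = w M; last exact: conv.
apply: functional_extensionality_dep => l; apply: funext => a.
by rewrite /w divff ?mul1r// gt_eqF.
Qed.

(** * From logarithmic to relative errors [(x - xt) / xt] *)

Definition expm1 u : state := fun l a => expR (u l a) - 1.
Arguments expm1 : clear implicits.

Lemma one_le_expR (x : R) : 0 <= x -> 1 <= expR x.
Proof. by move=> x0; rewrite (le_trans _ (expR_ge1Dx x))// lerDl. Qed.

Lemma expm1_le (e x : R) : `|x| <= e -> `|expR x - 1| <= expR e * `|x|.
Proof.
move=> xe; have [x0|x0] := leP 0 x.
  rewrite (ger0_norm x0) ger0_norm ?subr_ge0 ?one_le_expR//.
  have xe' : x <= e by rewrite (le_trans (ler_norm _)).
  apply: (@le_trans _ _ (expR x * x)); last by rewrite ler_wpM2r// ler_expR.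
  have := expR_ge1Dx (- x); rewrite expRN => h.
  have := ler_wpM2l (expR_ge0 x) h; rewrite divff ?gt_eqF ?expR_gt0//; lra.
have e0 : 0 <= e by exact: le_trans xe.
have e1 : expR x - 1 < 0 by rewrite subr_lt0 expR_lt1.
rewrite (ltr0_norm e1) (ltr0_norm x0).
apply: (@le_trans _ _ (- x)); first by have := expR_ge1Dx x; lra.
by rewrite ler_peMl ?one_le_expR// oppr_ge0 ltW.
Qed.

Lemma expm1_ge (e x : R) : `|x| <= e -> `|x| <= expR e * `|expR x - 1|.
Proof.
move=> xe; have [x0|x0] := leP 0 x.
  have e0 : 0 <= e by exact: le_trans xe.
  rewrite (ger0_norm x0) ger0_norm ?subr_ge0 ?one_le_expR//.
  apply: (@le_trans _ _ (expR x - 1)); first by have := expR_ge1Dx x; lra.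
  by rewrite ler_peMl ?one_le_expR// subr_ge0 one_le_expR.
have e1 : expR x - 1 < 0 by rewrite subr_lt0 expR_lt1.
rewrite (ltr0_norm e1) (ltr0_norm x0).
apply: (@le_trans _ _ (expR (- x) * - (expR x - 1))).
  rewrite mulrN mulrBr -expRD addNr expR0 mulr1.
  by have := expR_ge1Dx (- x); lra.
rewrite ler_wpM2r ?ler_expR//; last by rewrite -ltr0_norm.
by rewrite oppr_ge0 subr_le0 expR_le1 ltW.
Qed.

Lemma iter_contraction u : exists nu : R, exists2 k0 : nat, 0 < nu < 1 &
  forall k, (k0 <= k)%N ->
  wnorm (expm1 (iter k.+1 log_step u)) <= nu * wnorm (expm1 (iter k log_step u)).
Proof.
have [nu [e1 [nu0 nu1 e10 contr]]] := local_contraction.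
(* Passing from relative errors to logarithms and back costs [expR (2 * e)]; with [e <= - ln nu / 4]
   the product with [nu] is at most the square root of [nu]. *)
pose e := Num.min e1 (- ln nu / 4).
have lnu : ln nu < 0 by rewrite ln_lt0// nu0.
have e0 : 0 < e by rewrite lt_min e10 divr_gt0// oppr_gt0.
have [k0 hk0] := iter_global u e0.
exists (expR e * expR e * nu), k0.
  rewrite !mulr_gt0 ?expR_gt0//= -{1}(lnK (x := nu)) ?posrE// -!expRD expR_lt1.
  have : e <= - ln nu / 4 by rewrite ge_min lexx orbT.
  by lra.
move=> k kk0; set v := iter k log_step u.
have v1 : forall l, l != i -> forall a, `|log_step v l a| <= e.
  by move=> l li a; apply: (hk0 k.+1) => //; exact: leq_trans kk0 _.
have v0 : forall l, l != i -> forall a, `|v l a| <= e by exact: hk0.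
have scale x y : (forall l, l != i -> forall a, `|x l a| <= expR e * `|y l a|) ->
    wnorm x <= expR e * wnorm y.
  move=> xy; rewrite -[expR e in leRHS]gtr0_norm ?expR_gt0// -wnormZ.
  apply: wnorm_le => l li a; rewrite /scale_state normrM gtr0_norm ?expR_gt0//.
  exact: xy.
apply: (@le_trans _ _ (expR e * wnorm (log_step v))).
  by apply: scale => l li a; apply: expm1_le; exact: v1.
rewrite -!mulrA ler_pM2l ?expR_gt0//.
apply: (@le_trans _ _ (nu * wnorm v)).
  apply: contr => l li a; apply: le_trans (v0 l li a) _.
  by rewrite ge_min lexx.
rewrite [leRHS]mulrCA ler_pM2l//.
by apply: scale => l li a; apply: expm1_ge; exact: v0.
Qed.

End Dynamics.

(** The quotient is [Qf] along one coordinate at a point of unit norms, [1 - x ^ p] being the share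
    of the other coordinates. The base of the outer power is 1 at [t = 0], so the derivative there
    is [g - lam * x ^ (p - 1)]. *)
Lemma critical_quotient (R : realType) (lam g x p : R) :
  0 < lam -> 0 < x -> 0 < p ->
  is_derive (0 : R) (1 : R) (fun t : R =>
    `|lam + t * g| / (`|x + t| `^ p + (1 - x `^ p)) `^ p^-1) 0 ->
  g = lam * x `^ (p - 1).
Proof.
move=> lam0 x0 p0 dF.
have d1 : is_derive (0 : R) 1 (fun t : R => x + t) 1.
  have := is_deriveD (is_derive_cst x (0 : R) 1) (is_derive_id (0 : R) 1).
  by rewrite add0r.
have d2 : is_derive (0 : R) 1 (fun t : R => (x + t) `^ p) (p * x `^ (p - 1)).
  have x0' : 0 < x + 0 by rewrite addr0.
  have := @is_derive1_comp _ (fun y => y `^ p) (fun t : R => x + t) 0 _ _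
    (is_derive1_powR p x0') d1.
  by rewrite addr0 mulr1.
have d3 : is_derive (0 : R) 1 (fun t : R => (x + t) `^ p + (1 - x `^ p))
    (p * x `^ (p - 1)).
  have := is_deriveD d2 (is_derive_cst (1 - x `^ p) (0 : R) 1).
  by rewrite addr0.
have d4 : is_derive (0 : R) 1
    (fun t : R => ((x + t) `^ p + (1 - x `^ p)) `^ (- p^-1)) (- x `^ (p - 1)).
  have y1 : (x + 0) `^ p + (1 - x `^ p) = 1 by rewrite addr0 addrC subrK.
  have y0 : 0 < (x + 0) `^ p + (1 - x `^ p) by rewrite y1.
  have := @is_derive1_comp _ (fun y => y `^ (- p^-1))
    (fun t : R => (x + t) `^ p + (1 - x `^ p)) 0 _ _
    (is_derive1_powR (- p^-1) y0) d3.
  by rewrite y1 powR1 mulr1 mulNr mulKf// gt_eqF.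
have d5 : is_derive (0 : R) 1 (fun t : R => lam + t * g) g.
  have := is_deriveD (is_derive_cst lam (0 : R) 1)
    (is_deriveM (is_derive_id (0 : R) 1) (is_derive_cst g (0 : R) 1)).
  by rewrite add0r scaler0 add0r /cst/= /GRing.scale/= mulr1.
have := is_deriveM d5 d4.
set F2 := (X in is_derive _ _ X _) => d6.
(* Both absolute values have positive arguments near [0], where the quotient is a product of smooth
   functions. *)
have nearE : \forall t \near (0 : R), `|lam + t * g| /
    (`|x + t| `^ p + (1 - x `^ p)) `^ p^-1 = F2 t.
  have c1 : \forall t \near (0 : R), 0 < x + t.
    have : {for (0 : R), continuous (fun t : R => x + t)}.
      apply: differentiable_continuous; apply/derivable1_diffP.
      by case: d1.
    move=> /cvgr_gt; apply; by rewrite addr0.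
  have c2 : \forall t \near (0 : R), 0 < lam + t * g.
    have : {for (0 : R), continuous (fun t : R => lam + t * g)}.
      apply: differentiable_continuous; apply/derivable1_diffP.
      by case: d5.
    move=> /cvgr_gt; apply; by rewrite mul0r addr0.
  near=> t.
  have t1 : 0 < x + t by near: t.
  have t2 : 0 < lam + t * g by near: t.
  by rewrite /F2 !gtr0_norm// -powRN.
have := near_eq_derive (1 : R) nearE; rewrite (@derive_val _ _ _ _ _ _ _ dF).
rewrite (@derive_val _ _ _ _ _ _ _ d6) => /eqP.
rewrite mul0r !addr0 [x `^ p + _]addrC subrK powR1 /GRing.scale/= mul1r.
by rewrite mulrN eq_sym addrC subr_eq0 => /eqP.
Unshelve. all: by end_near.
Qed.

Arguments mu {R m d} rho l a.
Arguments wt {R m d} rho l a j.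
Arguments logsum {R m d} i u j.
Arguments inner_log {R m d} i rho u b.
Arguments outer_log {R m d} i q rho u l j.
Arguments log_s {R m d} i p q rho u k _.
Arguments log_norm {R m d} p rho u l.
Arguments log_step {R m d} i p q rho u k _.
Arguments normalized {R m d} i p rho u.
Arguments wsum {R m} i p M.
Arguments wnorm {R m d} i p rho u.
Arguments expm1 {R m d} u k _.

(** * Translation of the tensor iteration into logarithmic coordinates *)

Section TensorDynamics.
Variables (R : realType) (m : nat) (d : 'I_m -> nat).
Variables (f : tensor R d) (p : 'I_m -> R) (i : 'I_m) (xt : state R d).
Arguments xt : clear implicits.
Local Notation J := (mindex d).
Implicit Types (x u : state R d).

Hypothesis f_ge0 : nonneg_tensor f.
Hypothesis f_irr : weakly_irreducible f.
Hypothesis p_gt1 : forall k, 1 < p k.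
Hypothesis xt_S : in_Spp p xt.
Hypothesis xt_sing : singular_vector f p xt.

Let p_gt0 k : 0 < p k. Proof. by rewrite (lt_trans _ (p_gt1 k)). Qed.
Let pm1_gt0 k : 0 < p k - 1. Proof. by rewrite subr_gt0. Qed.
Let xt_gt0 k a : 0 < xt k a. Proof. by have [] := xt_S k. Qed.
Hint Resolve p_gt0 pm1_gt0 xt_gt0 : core.

Lemma upd_in x k v a : @upd R m d x k v k a = v a.
Proof. by rewrite /upd dfwithin. Qed.

Lemma upd_out x k v l a : l != k -> @upd R m d x k v l a = x l a.
Proof. by move=> lk; rewrite /upd dfwithout// eq_sym. Qed.

Lemma mlform_grad x k : mlform f x = \sum_b x k b * @grad R m d f k x b.
Proof.
rewrite /mlform (partition_big (fun j : J => j k) xpredT)//=.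
apply: eq_bigr => b _; rewrite /grad mulr_sumr; apply: eq_bigr => j /eqP <-.
by rewrite (bigD1 k)//= mulrCA.
Qed.

Lemma grad_upd x k v a : @grad R m d f k (@upd R m d x k v) a = grad f x a.
Proof.
apply: eq_bigr => j _; congr (_ * _); apply: eq_bigr => l lk.
exact: upd_out.
Qed.

Let lam := mlform f xt.

Lemma lam_gt0 : 0 < lam.
Proof.
case: xt_sing => lam0 _; rewrite lt_neqAle eq_sym lam0.
apply: sumr_ge0 => j _; rewrite mulr_ge0//; apply: prodr_ge0 => k _.
exact: ltW.
Qed.
Hint Resolve lam_gt0 : core.

Lemma xt_norm k : \sum_b xt k b `^ p k = 1.
Proof.
have [_ /eqP] := xt_S k; rewrite /pnorm powR_eq1 invr_eq0 (gt_eqF (p_gt0 k)) orbF.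
rewrite ltNge sumr_ge0//= ?orbF => /eqP <-.
by apply: eq_bigr => b _; rewrite gtr0_norm.
Qed.

Lemma Qf_xt : Qf f p xt = lam.
Proof.
rewrite /Qf -/lam gtr0_norm// big1 ?divr1// => k _.
by have [] := xt_S k.
Qed.

Lemma Qf_upd k a (t : R) :
  Qf f p (@upd R m d xt k (fun b => xt k b + (if b == a then t else 0))) =
  `|lam + t * @grad R m d f k xt a| /
    (`|xt k a + t| `^ p k + (1 - xt k a `^ p k)) `^ (p k)^-1.
Proof.
rewrite /Qf; congr (`|_| / _).
  rewrite (mlform_grad _ k) /lam (mlform_grad _ k) (bigD1 a)//= [in RHS](bigD1 a)//=.
  rewrite upd_in eqxx grad_upd mulrDl addrAC; congr (_ + _ + _).
  by apply: eq_bigr => b ba; rewrite upd_in (negbTE ba) addr0 grad_upd.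
rewrite (bigD1 k)//= big1 ?mulr1; last first.
  move=> l lk; have [_ <-] := xt_S l; congr pnorm.
  by apply: funext => b; exact: upd_out.
rewrite /pnorm; congr (_ `^ _); rewrite (bigD1 a)//= upd_in eqxx; congr (_ + _).
rewrite -(xt_norm k) [X in X - _](bigD1 a)//= addrAC subrr add0r.
by apply: eq_bigr => b ba; rewrite upd_in (negbTE ba) addr0 gtr0_norm.
Qed.

Lemma grad_xt k a : @grad R m d f k xt a = lam * xt k a `^ (p k - 1).
Proof.
case: xt_sing => _ /(_ k a); rewrite (funext (Qf_upd a)).
by apply: critical_quotient; [exact: lam_gt0|exact: xt_gt0|exact: p_gt0].
Qed.

Definition rho (j : J) : R := f j * (\prod_k xt k (j k)) / lam.

Lemma powR_pm1 k a : xt k a `^ p k = xt k a * xt k a `^ (p k - 1).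
Proof.
rewrite -{2}[xt k a]powRr1 ?(ltW (xt_gt0 a))// -powRD; first by rewrite addrC subrK.
by rewrite (gt_eqF (xt_gt0 a)) implybT.
Qed.

Lemma mu_rho k a : mu rho k a = xt k a `^ p k.
Proof.
have -> : mu rho k a = xt k a * @grad R m d f k xt a / lam.
  rewrite /mu /grad mulr_sumr mulr_suml; apply: eq_bigr => j /eqP <-.
  by rewrite /rho (bigD1 k)//= mulrCA.
by rewrite grad_xt powR_pm1 mulrCA mulrAC divff ?mul1r// gt_eqF.
Qed.

Lemma mu_rho_gt0 k a : 0 < mu rho k a.
Proof. by rewrite mu_rho powR_gt0. Qed.

Lemma rho_prob : prob rho.
Proof.
split=> [j|]; last by rewrite -mulr_suml divff// gt_eqF.
rewrite /rho divr_ge0 ?(ltW lam_gt0)// mulr_ge0//; apply: prodr_ge0 => k _.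
exact: ltW.
Qed.

Lemma rho_irr : weakly_irreducible rho.
Proof.
move=> x y; have -> : connect (wi_edge rho) x y = connect (wi_edge f) x y.
  apply: eq_connect => {}x {}y; rewrite /wi_edge; congr (_ && _).
  apply: eq_existsb => j; congr [&& _, _ & _].
  rewrite /rho -mulrA pmulr_lgt0// divr_gt0//; apply: prodr_gt0 => k _.
  exact: xt_gt0.
exact: f_irr.
Qed.

Let q := hconj (p i) - 1.

Lemma hconjB1 k : hconj (p k) - 1 = (p k - 1)^-1.
Proof. by rewrite /hconj; field; rewrite gt_eqF. Qed.

(** Tilting the other blocks by [expR h] multiplies the gradient at [xt] by the conditional mean of
    [expR h]: the terms of the gradient at [xt], divided by their sum, are the weights
    [wt rho k a]. *)
Lemma grad_exp k (z : state R d) (c : R) (h : J -> R) a :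
  (forall j : J, \prod_(l | l != k) z l (j l) =
     c * (\prod_(l | l != k) xt l (j l)) * expR (h j)) ->
  @grad R m d f k z a =
    c * lam * xt k a `^ (p k - 1) * expR (lav (wt rho k a) h).
Proof.
move=> hz; rewrite expR_lav; last exact: prob_wt rho_prob mu_rho_gt0 _ _.
rewrite av_wt.
rewrite mu_rho powR_pm1 mulrA mulr_sumr mulr_suml; apply: eq_bigr => j /eqP ja.
rewrite hz /rho [in RHS](bigD1 k)//= ja.
have X0 : xt k a `^ (p k - 1) != 0 by rewrite gt_eqF// powR_gt0.
by field; rewrite X0 !gt_eqF.
Qed.

Lemma root_exp k a (A h : R) : 0 < A ->
  (A * xt k a `^ (p k - 1) * expR h) `^ (p k - 1)^-1 =
  A `^ (p k - 1)^-1 * xt k a * expR (h / (p k - 1)).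
Proof.
move=> A0; rewrite powRM ?expR_ge0 ?mulr_ge0 ?powR_ge0 ?(ltW A0)//.
rewrite powRM ?powR_ge0 ?(ltW A0)// -powRrM -expRM divff ?gt_eqF//.
by rewrite powRr1// ltW.
Qed.

Lemma psi_gt0 (n : nat) (r : R) (v : 'I_n -> R) j :
  0 < v j -> psi r v j = v j `^ (r - 1).
Proof. by move=> vj; rewrite /psi gtr0_norm// gtr0_sg// mulr1. Qed.

Definition logcoord x u := forall l, l != i ->
  forall a, x l a = xt l a * expR (u l a).

(** The gradient in slot [i] leaves [lam ^ q] after [psi], the gradient in slot [l] contributes one
    more [lam], and the last [psi] takes the power [1 / (p l - 1)]. *)
Lemma s_exp x u l a : logcoord x u -> l != i ->
  @s_ik R m d f p i l x a =
  lam `^ ((1 + q) / (p l - 1)) * xt l a * expR (log_s i p q rho u l a).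
Proof.
move=> xu li.
have prodE (P : pred 'I_m) (j : J) : (forall k, P k -> k != i) ->
    \prod_(k | P k) x k (j k) =
    (\prod_(k | P k) xt k (j k)) * expR (\sum_(k | P k) u k (j k)).
  move=> Pi; rewrite expR_sum -big_split; apply: eq_bigr => k /Pi ki.
  exact: xu.
have gi b : @grad R m d f i x b =
    1 * lam * xt i b `^ (p i - 1) * expR (inner_log i rho u b).
  by apply: grad_exp => j; rewrite mul1r prodE.
have yi b : psi (hconj (p i)) (@grad R m d f i x) b =
    lam `^ q * xt i b * expR (q * inner_log i rho u b).
  rewrite psi_gt0 ?gi; last by rewrite !mulr_gt0 ?expR_gt0 ?powR_gt0.
  by rewrite hconjB1 mul1r root_exp// /q hconjB1 [_^-1 * _]mulrC.
rewrite /s_ik; set z := upd _ _.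
have gl : @grad R m d f l z a = lam `^ q * lam * xt l a `^ (p l - 1) *
    expR (lav (wt rho l a) (outer_log i q rho u l)).
  apply: grad_exp => j; rewrite (bigD1 i) 1?eq_sym//= /z upd_in yi.
  rewrite [in RHS](bigD1 i) 1?eq_sym//= /outer_log expRD.
  rewrite (eq_bigr (fun k => x k (j k))); last first.
    by move=> k /andP[_ ki]; exact: upd_out.
  rewrite prodE; last by move=> k /andP[].
  rewrite /logsum_but (eq_bigl (fun k => (k != i) && (k != l))); last first.
    by move=> k; rewrite andbC.
  rewrite [in RHS](eq_bigl (fun k => (k != i) && (k != l))); last first.
    by move=> k; rewrite andbC.
  rewrite [\sum_(k | (k != l) && (k != i)) _](eq_bigl (fun k => (k != i) && (k != l))); last first.
    by move=> k; rewrite andbC.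
  by ring.
have A0 : 0 < lam `^ q * lam by rewrite mulr_gt0 ?powR_gt0.
rewrite psi_gt0 gl; last by rewrite !mulr_gt0 ?expR_gt0 ?powR_gt0.
rewrite hconjB1 root_exp// /log_s; congr (_ * _ * _).
have -> : lam `^ q * lam = lam `^ (1 + q); last by rewrite -powRrM.
rewrite (@powRD _ lam 1 q); last by rewrite (gt_eqF lam_gt0) implybT.
by rewrite powRr1 ?(ltW lam_gt0)// mulrC.
Qed.

Lemma pnorm_exp l (c : R) (v : 'I_(d l) -> R) u : 0 < c ->
  (forall a, v a = c * xt l a * expR (u l a)) ->
  pnorm (p l) v = c * expR (log_norm p rho u l).
Proof.
move=> c0 hv; rewrite /pnorm.
have -> : \sum_j `|v j| `^ p l =
    c `^ p l * expR (lav rho (fun j => p l * u l (j l))).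
  rewrite expR_lav; last exact: rho_prob.
  rewrite /av (partition_big (fun j : J => j l) xpredT)//= mulr_sumr.
  apply: eq_bigr => a _.
  rewrite (eq_bigr (fun j => rho j * expR (p l * u l a))); last first.
    by move=> j /eqP <-.
  rewrite -mulr_suml -/(mu rho l a) mu_rho hv gtr0_norm ?mulr_gt0 ?expR_gt0//.
  rewrite powRM ?mulr_ge0 ?expR_ge0 ?(ltW c0) ?(ltW (xt_gt0 a))//.
  by rewrite powRM ?(ltW c0) ?(ltW (xt_gt0 a))// -expRM mulrA [u l a * _]mulrC.
rewrite powRM ?expR_ge0 ?powR_ge0// -powRrM divff ?gt_eqF// powRr1 ?(ltW c0)//.
by rewrite -expRM.
Qed.

Lemma step_exp x u : logcoord x u ->
  logcoord (hgpm_step f p i x) (log_step i p q rho u).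
Proof.
move=> xu l li a; rewrite /hgpm_step (negbTE li).
have k0 : 0 < lam `^ ((1 + q) / (p l - 1)) by rewrite powR_gt0.
rewrite (pnorm_exp k0 (fun b => s_exp b xu li)) (s_exp a xu li).
rewrite /log_step expRB.
have arith (c e1 e2 y : R) : 0 < c -> 0 < e1 ->
    c * y * e2 / (c * e1) = y * (e2 / e1).
  by move=> c0 e10; field; rewrite !gt_eqF.
by apply: arith => //; exact: expR_gt0.
Qed.

(** * The bounds in terms of the rates *)

Hypothesis m_ge2 : (2 <= m)%N.
Hypothesis index_ok : forall l, l != i -> (m - 1)%:R * hconj (p i) <= p l.

Let hconjE : 1 + q = hconj (p i). Proof. by rewrite /q addrC subrK. Qed.
Let q_gt0 : 0 < q. Proof. by rewrite /q hconjB1 invr_gt0. Qed.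
Let p_ge l : l != i -> (m - 1)%:R * (1 + q) <= p l.
Proof. by rewrite hconjE; exact: index_ok. Qed.
Let n_gt0 : 0 < (m - 1)%:R :> R. Proof. by rewrite ltr0n subn_gt0. Qed.
Let hconj_gt0 : 0 < hconj (p i).
Proof. by rewrite -hconjE addr_gt0. Qed.

(** A unit vector excludes an empty block; hence [sup] and [inf] over a block are attained and not
    default values. *)
Lemma dim_inhabited l : inhabited 'I_(d l).
Proof.
have := xt_norm l; case: (posnP (d l)) => [d0|d0 _]; last by split; exact: Ordinal d0.
rewrite big1 => [/esym/eqP|b _]; first by rewrite oner_eq0.
by case: b => b bd; exfalso; move: bd; rewrite d0.
Qed.

Lemma sup_range_max (T : Type) (h : T -> R) t :
  (forall s, h s <= h t) -> sup (range h) = h t.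
Proof.
move=> ht; apply/le_anti/andP; split.
  by apply: ge_sup => [|_ [s _ <-]]; [exists (h t), t|exact: ht].
by apply: ub_le_sup; [exists (h t) => _ [s _ <-]|exists t].
Qed.

Lemma inf_range_min (T : Type) (h : T -> R) t :
  (forall s, h t <= h s) -> inf (range h) = h t.
Proof.
move=> ht; apply/le_anti/andP; split.
  by apply: ge_inf; [exists (h t) => _ [s _ <-]|exists t].
by apply: lb_le_inf => [|_ [s _ <-]]; [exists (h t), t|exact: ht].
Qed.

Lemma argmax (T : finType) (h : T -> R) : inhabited T ->
  exists t, forall s, h s <= h t.
Proof.
move=> [t0]; have [t _ ht] := arg_maxP h (erefl (xpredT t0)).
by exists t => s; exact: ht.
Qed.

Lemma argmin (T : finType) (h : T -> R) : inhabited T ->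
  exists t, forall s, h t <= h s.
Proof.
move=> [t0]; have [t _ ht] := arg_minP h (erefl (xpredT t0)).
by exists t => s; exact: ht.
Qed.

Definition gap u l (a : 'I_(d l)) : R := log_s i p q rho u l a - u l a.
Definition urate u (l : 'I_m) : R := sup (range (@gap u l)).
Definition lrate u (l : 'I_m) : R := inf (range (@gap u l)).

Lemma urateP u l : exists2 t, urate u l = @gap u l t &
  forall a, @gap u l a <= @gap u l t.
Proof.
have [t ht] := argmax (@gap u l) (dim_inhabited l).
by exists t => //; exact: sup_range_max.
Qed.

Lemma lrateP u l : exists2 t, lrate u l = @gap u l t &
  forall a, @gap u l t <= @gap u l a.
Proof.
have [t ht] := argmin (@gap u l) (dim_inhabited l).
by exists t => //; exact: inf_range_min.
Qed.

Lemma ratio_exp x u l a : logcoord x u -> l != i ->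
  @s_ik R m d f p i l x a / x l a =
  lam `^ ((1 + q) / (p l - 1)) * expR (gap u a).
Proof.
move=> xu li; rewrite (s_exp a xu li) xu// /gap expRB.
by field; rewrite !gt_eqF ?expR_gt0.
Qed.

(** Since [1 + q] is the conjugate exponent of [p i], each of the [m - 1] factors carries [lam] to
    the power [1 / (m - 1)]; the same exponents turn the rates into [wsum]. *)
Lemma prod_rates (M : 'I_m -> R) :
  \prod_(l < m | l != i) (lam `^ ((1 + q) / (p l - 1)) * expR (M l))
    `^ ((p l - 1) / (hconj (p i) * (m - 1)%:R)) =
  lam * expR (wsum i p M / (hconj (p i) * (m - 1)%:R)).
Proof.
rewrite -{2}(lnK lam_gt0) -expRD.
have -> : ln lam + wsum i p M / (hconj (p i) * (m - 1)%:R) =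
    \sum_(l | l != i) ((1 + q) / (p l - 1) * ln lam + M l) *
      ((p l - 1) / (hconj (p i) * (m - 1)%:R)).
  rewrite /wsum mulr_suml.
  have {1}-> : ln lam = \sum_(l : 'I_m | l != i) ln lam / (m - 1)%:R.
    under eq_bigr do rewrite -[ln lam]mul1r -mulrA.
    by rewrite -mulr_suml card_off_i mulrC mulrVK// unitfE gt_eqF.
  rewrite -big_split; apply: eq_bigr => l _ /=; rewrite hconjE.
  by field; rewrite !gt_eqF.
rewrite expR_sum; apply: eq_bigr => l _; rewrite expRM expRD.
by rewrite /powR (gt_eqF lam_gt0).
Qed.

Lemma lam_plus_exp x u : logcoord x u -> hgpm_lam_plus f p i x =
  lam * expR (wsum i p (urate u) / (hconj (p i) * (m - 1)%:R)).
Proof.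
move=> xu; rewrite -prod_rates; apply: eq_bigr => l li; congr (_ `^ _).
have [t -> ht] := urateP u l.
rewrite (@sup_range_max _ _ t); first exact: ratio_exp.
by move=> a; rewrite !(ratio_exp _ xu li) ler_pM2l ?powR_gt0// ler_expR.
Qed.

Lemma lam_minus_exp x u : logcoord x u -> hgpm_lam_minus f p i x =
  lam * expR (wsum i p (lrate u) / (hconj (p i) * (m - 1)%:R)).
Proof.
move=> xu; rewrite -prod_rates; apply: eq_bigr => l li; congr (_ `^ _).
have [t -> ht] := lrateP u l.
rewrite (@inf_range_min _ _ t); first exact: ratio_exp.
by move=> a; rewrite !(ratio_exp _ xu li) ler_pM2l ?powR_gt0// ler_expR.
Qed.

Lemma wsum_le (M M' : 'I_m -> R) : (forall l, l != i -> M l <= M' l) ->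
  wsum i p M <= wsum i p M'.
Proof. by move=> h; apply: ler_sum => l li; rewrite ler_pM2l// h. Qed.

Local Notation step := (log_step i p q rho).

Lemma urate_step u : normalized i p rho u ->
  wsum i p (urate (step u)) <= wsum i p (urate u).
Proof.
move=> nu.
have h l : l != i -> forall a, log_s i p q rho u l a <= u l a + urate u l.
  by move=> li a; have [t -> /(_ a)] := urateP u l; rewrite lerBlDl.
have [M' MM hM'] :=
  upper_rate_step rho_prob mu_rho_gt0 q_gt0 p_gt1 p_ge nu h.
apply: le_trans MM; apply: wsum_le => l li.
by have [t -> _] := urateP (step u) l; rewrite lerBlDl; exact: hM'.
Qed.

Lemma lrate_step u : normalized i p rho u ->
  wsum i p (lrate u) <= wsum i p (lrate (step u)).
Proof.
move=> nu.
have h l : l != i -> forall a, u l a + lrate u l <= log_s i p q rho u l a.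
  by move=> li a; have [t -> /(_ a)] := lrateP u l; rewrite lerBrDl.
have [M' MM hM'] :=
  lower_rate_step rho_prob mu_rho_gt0 q_gt0 p_gt1 p_ge nu h.
apply: (le_trans MM); apply: wsum_le => l li.
by have [t -> _] := lrateP (step u) l; rewrite lerBrDl; exact: hM'.
Qed.

Lemma gap_small u (e : R) : 0 <= e ->
  (forall l, l != i -> forall a, `|u l a| <= e) ->
  forall l, l != i -> forall a, `|@gap u l a| <= 2 * e.
Proof.
move=> e0 ue l li a; rewrite (le_trans (ler_normB _ _))//.
have := log_s_norm rho_prob mu_rho_gt0 q_gt0 p_gt1 p_ge e0 ue li a.
by have := ue l li a; lra.
Qed.

(** * The sequences produced by the method *)

Variable x0 : state R d.
Arguments x0 : clear implicits.
Hypothesis x0_S : in_Spp_i p i x0.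

Let u0 : state R d := fun l a => ln (x0 l a / xt l a).
Let U k := iter k step u0.
Let xs := hgpm_x f p i x0.
Arguments U : clear implicits.
Arguments xs : clear implicits.

Lemma logcoord_x0 : logcoord x0 u0.
Proof.
move=> l li a; have [x0p _] := x0_S li.
by rewrite /u0 lnK ?posrE ?divr_gt0// mulrC divfK// gt_eqF.
Qed.

Lemma logcoord_xs k : logcoord (xs k) (U k).
Proof.
elim: k => [|k IH]; first exact: logcoord_x0.
by rewrite /xs /hgpm_x /U !iterS; exact: step_exp.
Qed.

(** Index 0 is covered by the unit norms of [x0]; monotonicity of the bounds at the very first step
    rests on it. *)
Lemma normalized_U k : normalized i p rho (U k).
Proof.
case: k => [|k]; last exact: (log_step_normalized q rho_prob p_gt1).
move=> l li; have [_] := x0_S li.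
rewrite (@pnorm_exp l 1 (x0 l) u0) ?mul1r//; last first.
  by move=> a; rewrite mul1r; exact: logcoord_x0.
by move/(congr1 (@ln R)); rewrite expRK ln1.
Qed.

Lemma U_tends0 : tends0 i U.
Proof.
exact: (iter_global rho_prob mu_rho_gt0 q_gt0 p_gt1 p_ge m_ge2 rho_irr).
Qed.

(** Serves both bounds: either rate is a value of [gap], which is at most twice the sup norm of
    [U k]. *)
Lemma wsum_cvg0 (rate : state R d -> 'I_m -> R) :
  (forall u l, exists t, rate u l = @gap u l t) ->
  lam * expR (wsum i p (rate (U k)) / (hconj (p i) * (m - 1)%:R)) @[k --> \oo]
    --> lam.
Proof.
move=> rateP; rewrite -[X in _ --> X](_ : lam * expR 0 = lam);
  last by rewrite expR0 mulr1.
apply: cvgM; first exact: cvg_cst.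
apply: continuous_cvg; first exact: continuous_expR.
rewrite -[X in _ --> X](mul0r (hconj (p i) * (m - 1)%:R)^-1).
apply: (@cvgM _ _ _ _ (fun k => wsum i p (rate (U k))) (fun=> _));
  last exact: cvg_cst.
apply/cvgrPdist_le => eps eps0.
pose W := 1 + \sum_(l | l != i) (p l - 1) * 2.
have W0 : 0 < W by rewrite ltr_wpDr// sumr_ge0// => l _; rewrite mulr_ge0// ltW.
have eW : 0 < eps / W by rewrite divr_gt0.
have [N hN] := U_tends0 eW; exists N => // k Nk /=.
rewrite sub0r normrN (le_trans (ler_norm_sum _ _ _))//.
apply: (@le_trans _ _ (\sum_(l | l != i) (p l - 1) * 2 * (eps / W))).
  apply: ler_sum => l li; rewrite normrM gtr0_norm// -mulrA ler_pM2l//.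
  have [t ->] := rateP (U k) l; apply: gap_small => //; first exact: ltW.
  exact: hN.
by rewrite -mulr_suml mulrA ler_pdivrMr// mulrC ler_pM2l// lerDr.
Qed.

Lemma lp_cvg : hgpm_lam_plus f p i (xs k) @[k --> \oo] --> lam.
Proof.
under eq_cvg do rewrite (lam_plus_exp (logcoord_xs _)).
by apply: wsum_cvg0 => u l; have [t -> _] := urateP u l; exists t.
Qed.

Lemma lm_cvg : hgpm_lam_minus f p i (xs k) @[k --> \oo] --> lam.
Proof.
under eq_cvg do rewrite (lam_minus_exp (logcoord_xs _)).
by apply: wsum_cvg0 => u l; have [t -> _] := lrateP u l; exists t.
Qed.

Let hn_gt0 : 0 < hconj (p i) * (m - 1)%:R. Proof. by rewrite mulr_gt0. Qed.

Lemma lp_decr k :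
  hgpm_lam_plus f p i (xs k.+1) <= hgpm_lam_plus f p i (xs k).
Proof.
rewrite !(lam_plus_exp (logcoord_xs _)) ler_pM2l// ler_expR ler_pM2r ?invr_gt0//.
exact: urate_step (normalized_U k).
Qed.

Lemma lm_incr k :
  hgpm_lam_minus f p i (xs k) <= hgpm_lam_minus f p i (xs k.+1).
Proof.
rewrite !(lam_minus_exp (logcoord_xs _)) ler_pM2l// ler_expR ler_pM2r ?invr_gt0//.
exact: lrate_step (normalized_U k).
Qed.

(** A nonincreasing sequence stays above its limit. *)
Lemma lp_ge k : lam <= hgpm_lam_plus f p i (xs k).
Proof.
rewrite -(cvg_lim _ lp_cvg)//; apply: nonincreasing_cvgn_ge.
  by apply/nonincreasing_seqP => j; exact: lp_decr.
by apply/cvg_ex; exists lam; exact: lp_cvg.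
Qed.

Lemma lm_le k : hgpm_lam_minus f p i (xs k) <= lam.
Proof.
rewrite -(cvg_lim _ lm_cvg)//; apply: nondecreasing_cvgn_le.
  by apply/nondecreasing_seqP => j; exact: lm_incr.
by apply/cvg_ex; exists lam; exact: lm_cvg.
Qed.

Lemma xs_cvg l : l != i -> forall a, (fun k => xs k l a) @ \oo --> xt l a.
Proof.
move=> li a.
rewrite (funext (fun k => logcoord_xs k li a)).
have : xt l a * expR (U k l a) @[k --> \oo] --> xt l a * expR 0.
  apply: cvgM; first exact: cvg_cst.
  apply: continuous_cvg; first exact: continuous_expR.
  apply/cvgrPdist_le => eps eps0.
  have [N hN] := U_tends0 eps0; exists N => // k Nk /=.
  by rewrite sub0r normrN; exact: hN.
by rewrite expR0 mulr1.
Qed.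

(** As the marginals of [rho] are [xt ^ p], the square of this norm is the sum over [l != i] and [a]
    of [(p l - 1) * xt l a ^ (p l - 2) * v l a ^ 2]. *)
Definition relnorm (v : state R d) : R :=
  wnorm i p rho (fun l a => v l a / xt l a).

Lemma relnorm_norm : is_norm_off i relnorm.
Proof.
split; last split.
- move=> x y; apply: le_trans (wnormD i rho_prob mu_rho_gt0 p_gt1 _ _).
  by apply: (wnorm_le rho_prob p_gt1) => l li a; rewrite /add_state mulrDl.
- move=> a x; rewrite /relnorm -wnormZ; congr wnorm.
  apply: functional_extensionality_dep => l; apply: funext => b.
  by rewrite /scale_state mulrA.
- move=> x; split=> [x0' l li a|x0'].
    have [C _ /(_ (fun l a => x l a / xt l a) l li a)] :=
      sup_le_wnorm i rho_prob mu_rho_gt0 p_gt1.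
    rewrite -/(relnorm x) x0' mulr0 normr_le0 mulf_eq0 invr_eq0.
    by rewrite (gt_eqF (xt_gt0 a)) orbF => /eqP.
  have [C _ hC] := wnorm_le_sup i rho_prob p_gt1.
  apply/le_anti; rewrite wnorm_ge0 andbT -(mulr0 C); apply: hC => // l li a.
  by rewrite x0'// mul0r normr0.
Qed.

Lemma relnorm_xs k : relnorm (sub_state (xs k) xt) = wnorm i p rho (expm1 (U k)).
Proof.
have E l a : l != i ->
    @sub_state R m d (xs k) xt l a / xt l a = expm1 (U k) l a.
  move=> li; rewrite /sub_state (logcoord_xs _ li) /expm1.
  by field; rewrite gt_eqF.
by apply/le_anti/andP; split; apply: (wnorm_le rho_prob p_gt1) => l li a; rewrite E.
Qed.

Lemma relnorm_contraction : exists nu : R, exists2 k0 : nat, 0 < nu < 1 &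
  forall k, (k0 <= k)%N ->
  relnorm (sub_state (xs k.+1) xt) <= nu * relnorm (sub_state (xs k) xt).
Proof.
have [nu [k0 nu01 h]] :=
  iter_contraction rho_prob mu_rho_gt0 q_gt0 p_gt1 p_ge m_ge2 rho_irr u0.
by exists nu, k0 => // k kk0; rewrite !relnorm_xs; exact: h.
Qed.

End TensorDynamics.

(** Only [m = 2] asks for an argument: the hypothesis then reads [1 <= (p i0 - 1) * (p k - 1)] with
    [k] the other index. This is symmetric, so it holds for the chosen [i] too, and it is equivalent
    to [p_i' <= p_l]. *)
Lemma hgpm_index_hconj (R : realType) (m : nat) (p : 'I_m -> R) (i : 'I_m) :
  (forall k, 1 < p k) ->
  (exists i0 : 'I_m,
     (m - 1)%:R <= (p i0 - 1) * (inf [set p k | k in [set k | k != i0]] - (m - 1)%:R)) ->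
  hgpm_index p i ->
  forall l, l != i -> (m - 1)%:R * hconj (p i) <= p l.
Proof.
move=> p1 [i0 h]; rewrite /hgpm_index; case: eqP => [m2|_ hi]; last exact: hi.
move=> _ l li; subst m.
have two (k1 k2 k : 'I_2) : k1 != k2 -> k = k1 \/ k = k2.
  by move: k k1 k2; do 3!case=> -[|[|//]] ? //=; move=> _;
     by [left; apply: val_inj|right; apply: val_inj].
have infE (k1 k2 : 'I_2) : k1 != k2 -> inf [set p k | k in [set k | k != k1]] = p k2.
  move=> k12; rewrite (_ : [set p k | k in [set k | k != k1]] = [set p k2]) ?inf1//.
  apply/seteqP; split=> [_ [k /= kk1 <-]|_ ->]; last by exists k2; rewrite //= eq_sym.
  by have [kE|->] := two _ _ k k12; first by rewrite kE eqxx in kk1.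
have key : 1 <= (p i - 1) * (p l - 1).
  have [i0l|i0i] := two _ _ i0 li; move: h; rewrite ?i0l ?i0i /=.
    by rewrite (infE l i)// mulrC.
  by rewrite (infE i l)// eq_sym.
rewrite mul1r /hconj ler_pdivrMr ?subr_gt0//.
by move: key; lra.
Qed.

Theorem theorem2 (R : realType) (m : nat) (d : 'I_m -> nat)
  (f : tensor R d) (p : 'I_m -> R) (i : 'I_m) (x0 xt : state R d) :
  (2 <= m)%N ->
  nonneg_tensor f ->
  weakly_irreducible f ->
  (forall k, 1 < p k) ->
  (exists i0 : 'I_m,
     (m - 1)%:R <= (p i0 - 1) * (inf [set p k | k in [set k | k != i0]] - (m - 1)%:R)) ->
  hgpm_index p i ->
  in_Spp_i p i x0 ->
  in_Spp p xt ->
  singular_vector f p xt ->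
  Qf f p xt = tnorm f p ->
  let xs := hgpm_x f p i x0 in
  let lm := fun n => hgpm_lam_minus f p i (xs n) in
  let lp := fun n => hgpm_lam_plus f p i (xs n) in
  (forall n : nat,
     lm n <= lm n.+1 /\ lm n.+1 <= tnorm f p /\
     tnorm f p <= lp n.+1 /\ lp n.+1 <= lp n) /\
  lm @ \oo --> tnorm f p /\
  lp @ \oo --> tnorm f p /\
  (forall l, l != i -> forall j, (fun n => xs n l j) @ \oo --> xt l j) /\
  (exists (nu : R) (k0 : nat) (N : state R d -> R),
     0 < nu < 1 /\ is_norm_off i N /\
     forall k, (k0 <= k)%N ->
       N (sub_state (xs k.+1) xt) <= nu * N (sub_state (xs k) xt)).
Proof.
move=> m2 f0 firr p1 hi0 hi x0S xtS sing Qxt xs lm lp.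
have idx := hgpm_index_hconj p1 hi0 hi.
(* Maximality of [xt] identifies the tensor norm with [lam = f(xt)], the limit of both bounds. *)
rewrite -Qxt (Qf_xt f0 xtS sing).
split=> [n|]; first split; [|split; [|split]| ].
- exact: lm_incr.
- exact: lm_le.
- exact: lp_ge.
- exact: lp_decr.
split; first exact: lm_cvg.
split; first exact: lp_cvg.
split; first by move=> l li; exact: xs_cvg.
have [nu [k0 nu01 h]] := relnorm_contraction f0 firr p1 xtS sing m2 idx x0S.
exists nu, k0, (relnorm f p i xt); split=> //; split=> //.
exact: relnorm_norm.
Qed.
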